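(* Let $G$ be a finite simple graph with vertex set $V(G)=\{t_1,\ldots,t_s\}$, let $S=K[t_1,\ldots,t_s]$ be a polynomial ring over a field $K$, and let $I(G)\subset S$ be the edge ideal of $G$. If $G$ has no chordless cycles of length other than $3$ or $5$, then $$\mathrm{v}(I(G))\leq\mathrm{reg}(S/I(G)).$$
   Context: The edge ideal $I(G)$ is the ideal of $S$ generated by all $t_it_j$ with $\{t_i,t_j\}\in E(G)$. A chordless cycle is an induced cycle: a cycle such that no edge of $G$ joins two non-consecutive vertices of it. With the standard grading $S=\bigoplus_{d\ge0}S_d$, for a proper squarefree monomial ideal $I\subset S$ the v-number is $\mathrm{v}(I)=\min\{d\geq 0\mid \exists f\in S_d\text{ and }\mathfrak{p}\in\mathrm{Ass}(I)\text{ with }(I\colon f)=\mathfrak{p}\}$, where $\mathrm{Ass}(I)$ is the set of associated primes of $S/I$ and $(I\colon f)=\{g\in S\mid gf\in I\}$; in particular $\mathrm{v}(I)=0$ if $I$ is prime. The regularity of $S/I$ is $\mathrm{reg}(S/I)=\max\{j-i\mid b_{i,j}\neq0\}$, where $b_{i,j}$ are the graded Betti numbers of the minimal graded free resolution of $S/I$ over $S$. *)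

(* Defs.v *)
From mathcomp Require Import all_boot all_order all_algebra.
From mathcomp Require Export mpoly.

Set Implicit Arguments.
Unset Strict Implicit.
Unset Printing Implicit Defensive.

Import GRing.Theory.
Local Open Scope ring_scope.

Definition is_min (P : nat -> Prop) (d : nat) : Prop :=
  P d /\ forall d', P d' -> (d <= d')%N.

Definition is_max (P : int -> Prop) (r : int) : Prop :=
  P r /\ forall r', P r' -> r' <= r.

(* Subsets of a ring are Prop-valued: membership in a generated ideal or in a
   colon ideal is not a boolean predicate, so the boolean ideal predicates of
   ring_quotient do not apply. *)
Section Ideals.
Variable A : comNzRingType.
Implicit Types (X I P : A -> Prop) (f g : A).

Definition ideal_gen X : A -> Prop := fun g =>
  exists (n : nat) (a h : 'I_n -> A),
    (forall i, X (h i)) /\ g = \sum_(i < n) a i * h i.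

Definition is_ideal I : Prop :=
  [/\ I 0, forall f g, I f -> I g -> I (f + g) & forall a f, I f -> I (a * f)].

Definition is_prime_ideal P : Prop :=
  [/\ is_ideal P, ~ P 1 & forall f g, P (f * g) -> P f \/ P g].

Definition colon I f : A -> Prop := fun g => I (g * f).

(* P is the annihilator of the class of some g in A/I. *)
Definition associated_prime I P : Prop :=
  is_prime_ideal P /\ exists g, forall a, P a <-> colon I g a.

End Ideals.

Section Graphs.
Variable V : finType.

(* The edges joining two vertices of the cycle p are exactly those of p. *)
Definition chordless_cycle (e : rel V) (p : seq V) : Prop :=
  [/\ (3 <= size p)%N, ucycle e p &
      forall x y, x \in p -> y \in p -> e x y -> y = next p x \/ x = next p y].

End Graphs.

Section PolynomialRing.
Variables (K : fieldType) (s : nat).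
Local Notation S := {mpoly K[s]}.

Definition edge_ideal (e : rel 'I_s) : S -> Prop :=
  ideal_gen (fun m : S => exists i j : 'I_s, e i j /\ m = 'X_i * 'X_j).

Definition irrelevant_ideal : S -> Prop :=
  ideal_gen (fun m : S => exists i : 'I_s, m = 'X_i).

Definition is_vnumber (I : S -> Prop) (v : nat) : Prop :=
  is_min (fun d => exists (f : S) (P : S -> Prop),
    [/\ f \is d.-homog, associated_prime I P &
        forall g, colon I f g <-> P g]) v.

(* p lies in the graded component of degree d; only p = 0 does when d < 0. *)
Definition homogeneous (d : int) (p : S) : Prop :=
  forall m, m \in msupp p -> (mdeg m)%:Z = d.

(* A minimal graded free resolution
     ... -> F_2 -> F_1 -> F_0 -> S/I -> 0
   with F_i the sum of the S(- shift i k), k < rank i.  Elements of F_i are row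
   vectors, and the differential F_(i+1) -> F_i is u |-> u *m diff i.  The
   augmentation F_0 -> S/I sends the k-th basis element to the class of aug k,
   a homogeneous representative.  The ranks may vanish from some point on; the
   length is not required to be finite. *)
Record min_graded_free_resolution (I : S -> Prop) := MinGradedFreeResolution {
  rank : nat -> nat;
  shift : forall i, 'I_(rank i) -> int;
  aug : 'cV[S]_(rank 0%N);
  diff : forall i, 'M[S]_(rank i.+1, rank i);
  aug_graded : forall k, homogeneous (shift k) (aug k 0);
  diff_graded : forall i (k : 'I_(rank i.+1)) (l : 'I_(rank i)),
    homogeneous (shift k - shift l) (diff i k l);
  aug_surjective : forall g : S,
    exists u : 'rV[S]_(rank 0%N), I (g - (u *m aug) 0 0);
  aug_exact : forall u : 'rV[S]_(rank 0%N),
    I ((u *m aug) 0 0) <-> exists w : 'rV[S]_(rank 1%N), u = w *m diff 0%N;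
  diff_exact : forall i (u : 'rV[S]_(rank i.+1)),
    u *m diff i = 0 <-> exists w : 'rV[S]_(rank i.+2), u = w *m diff i.+1;
  diff_minimal : forall i (k : 'I_(rank i.+1)) (l : 'I_(rank i)),
    irrelevant_ideal (diff i k l)
}.

Definition betti (I : S -> Prop) (F : min_graded_free_resolution I)
    (i : nat) (j : int) : nat :=
  #|[set k : 'I_(rank F i) | shift k == j]|.

(* r = reg(S/I) *)
Definition is_regularity (I : S -> Prop) (r : int) : Prop :=
  exists F : min_graded_free_resolution I,
    is_max (fun d => exists (i : nat) (j : int),
      betti F i j <> 0%N /\ d = j - i%:Z) r.

End PolynomialRing.

(* Main.v *)
From HB Require Import structures.
Require Import Defs.
From mathcomp Require Import all_boot all_order all_algebra.
From mathcomp Require Import zify ring.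

(* Both invariants are compared with the size of an independent set sigma whose
   neighbourhood N(sigma) covers all edges. For f the product of the variables
   in sigma, (I(G) : f) is generated by the variables in N(sigma), so
   v(I(G)) <= |sigma|.

   For T contained in N(sigma), the element x^sigma e_T of the Koszul complex of
   S/I(G) is a cycle of degree |sigma| + |T|. It is not a boundary as soon as the
   independence complex of G[sigma u T] carries a simplicial cycle psi whose
   coefficient at sigma is nonzero, and then |sigma| <= reg(S/I(G)), by shifting
   Koszul cycles along a graded free resolution.

   Such sigma, T and psi are built by induction on the vertices. A vertex w2 is
   found with neighbours w1, w3 (possibly equal, and nonadjacent otherwise) such
   that any v1 in N(w1) - N[w2] and v3 in N(w3) - N[w2] are adjacent: either w1
   is dominated by w2, or w1 w2 w3 is an induced path that does not extend at
   both ends. From (sigma, T, psi) for G - N[w2] one passes to sigma + w2,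
   T + w1 + w3 and the suspension of psi between w2 and a filling of psi that
   uses w1 and w3. *)

Set Implicit Arguments.
Unset Strict Implicit.
Unset Printing Implicit Defensive.

Import Order.TTheory GRing.Theory Num.Theory.

(** * Extensions of induced paths *)

Section InducedPaths.
Variables (V : finType) (e : rel V).
Hypotheses (e_sym : symmetric e) (e_irr : irreflexive e).

Definition apart (x y : V) := (x != y) && ~~ e x y.

Lemma apart_sym : symmetric apart.
Proof. by move=> x y; rewrite /apart eq_sym e_sym. Qed.

Fixpoint induced_path (x : V) (p : seq V) : bool :=
  if p is y :: q then [&& e x y, x != y, all (apart x) q & induced_path y q]
  else true.

Lemma induced_path_path x p : induced_path x p -> path e x p.
Proof. by elim: p x => //= y p IHp x /and4P[-> _ _ /IHp]. Qed.

Lemma induced_path_uniq x p : induced_path x p -> uniq (x :: p).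
Proof.
elim: p x => //= y p IHp x /and4P[_ xy /allP ap /IHp /= ->].
rewrite inE negb_or xy andbT; apply/negP => /ap.
by rewrite /apart eqxx.
Qed.

Lemma induced_path_rcons x p z :
  induced_path x (rcons p z) =
  [&& induced_path x p, e (last x p) z, last x p != z &
      all (apart^~ z) (belast x p)].
Proof.
elim: p x => [|y p IHp] x /=; first by rewrite !andbT.
rewrite all_rcons IHp.
by case: (e x y); case: (x != y); case: (apart x z); case: (all _ p);
  case: (induced_path y p); rewrite /= ?andbF.
Qed.

Lemma induced_path_nth x p d i j : induced_path x p ->
  (i < j)%N -> (j <= size p)%N ->
  e (nth d (x :: p) i) (nth d (x :: p) j) -> j = i.+1.
Proof.
elim: p x i j => [|y p IHp] x [|i] [|j] //= /and4P[_ _ /allP ap ip] ij jp.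
- case: j ij jp => // j _ jp /=; have /ap: nth d p j \in p by exact: mem_nth.
  by case/andP=> _ /negPf->.
- by move=> eij; rewrite (IHp y i j ip ij jp eij).
Qed.


(** Strong induction on the length. A return to [x], or a chord from [x] to a later vertex, allows
    an initial piece to be skipped; otherwise [x] is adjacent to the next vertex only, and the tail
    is shortened. *)
Lemma induced_subpath x p : path e x p ->
  exists p', [/\ induced_path x p', last x p' = last x p & {subset p' <= p}].
Proof.
have [n] := ubnP (size p); elim: n => // n IHn in x p *.
rewrite ltnS => sp.
have shorten q1 u q2 : p = q1 ++ u :: q2 -> e x u -> q1 != [::] -> path e x p ->
    exists p', [/\ induced_path x p', last x p' = last x p & {subset p' <= p}].
  move=> defp xu q1n; rewrite defp cat_path /= => /and3P[_ _ uq2].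
  have [|/=|p' [ip' lp' sp']] := IHn x (u :: q2); last exists p'.
  - by move: sp; rewrite defp size_cat /=; case: q1 q1n {defp} => //= *; lia.
  - by rewrite xu.
  - by split=> //; [rewrite lp' last_cat | move=> z /sp' zq; rewrite mem_cat zq orbT].
have [xin|xnot] := boolP (x \in p).
  case/splitPr: xin sp => q1 q2 sp {shorten}; rewrite cat_path /= => /and3P[_ _ q2P].
  have [||p' [ip' lp' sp']] := IHn x q2 => //; last exists p'.
    by move: sp; rewrite size_cat /=; lia.
  split=> //; first by rewrite lp' last_cat.
  by move=> z /sp' zq; rewrite mem_cat inE zq !orbT.
case: p => [|y q] /= in sp xnot shorten *; first by exists [::].
have [/hasP [u uq xu]|/hasPn nadj] := boolP (has (e x) q).
  by case/splitPr: uq shorten => q1 q2 shorten; exact: (shorten (y :: q1) u q2).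
case/andP=> xy yq; have [||q' [iq' lq' sq']] := IHn y q => //.
exists (y :: q'); split=> //=; last first.
  by move=> z; rewrite !inE => /orP[->//|/sq'->]; rewrite orbT.
move: xnot; rewrite inE negb_or => /andP[xney xnq].
rewrite xy xney iq' andbT /=; apply/allP => z /sq' zq.
by rewrite /apart nadj // andbT; apply: contraNneq xnq => ->.
Qed.

(** The list [behead (belast x p)] holds the inner vertices of the path, so [w] sees exactly its two
    ends. On the path itself, adjacency forces consecutive positions. *)
Lemma close_induced_path x p w : (2 <= size p)%N -> induced_path x p ->
  e w x -> e (last x p) w -> w != x -> w != last x p ->
  all (apart w) (behead (belast x p)) ->
  chordless_cycle e (w :: x :: p).
Proof.
move=> sp ip wx lw wnx wnl apw.
have wp : w \notin x :: p.
  case/lastP: p => [//|q z] in sp ip lw wnl apw *.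
  rewrite last_rcons belast_rcons /= in lw wnl apw.
  rewrite inE mem_rcons inE !negb_or wnx wnl /=.
  by apply/negP => /(allP apw); rewrite /apart eqxx.
have wadj u : u \in x :: p -> e w u -> u = x \/ u = last x p.
  case/lastP: p => [//|q z] in sp ip lw wnl apw wp *.
  rewrite last_rcons belast_rcons /= in apw *.
  rewrite inE mem_rcons inE => /or3P[/eqP->|/eqP->|/(allP apw)]; auto.
  by case/andP=> _ /negPf->.
have uq : uniq (w :: x :: p) by rewrite cons_uniq wp induced_path_uniq.
split=> [||].
- by rewrite /= !ltnS ltnW.
- rewrite /ucycle; apply/andP; split=> //=.
  by rewrite wx rcons_path lw induced_path_path.
have next_last : next (w :: x :: p) (last x p) = w.
  (* [next] looks up the tail of the cycle with its head [w] as default value. The index of the last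
     vertex is the length of that tail, so the cycle closes through the default. *)
  rewrite next_nth inE mem_last orbT.
  rewrite (_ : index _ _ = (size p).+1) ?nth_default //.
  rewrite /= (negPf wnl); congr _.+1.
  have -> : last x p = nth x (x :: p) (size p) by rewrite nth_last.
  by rewrite -[if _ then _ else _]/(index _ (x :: p)) index_uniq // induced_path_uniq.
have next_w : next (w :: x :: p) w = x by rewrite /= eqxx.
have next_path i : (i < size p)%N ->
    next (w :: x :: p) (nth w (x :: p) i) = nth w (x :: p) i.+1.
  move=> ip'; rewrite next_nth inE mem_nth ?orbT //=; last by lia.
  have /negPf-> : w != nth w (x :: p) i.
    by apply: contraNneq wp => {1}->; apply: mem_nth; rewrite /=; lia.
  rewrite -[if _ then _ else _]/(index _ (x :: p)) index_uniq //=; last first.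
  - by have := induced_path_uniq ip.
  - by lia.
have key u v : u \in x :: p -> v \in x :: p ->
    (index u (x :: p) < index v (x :: p))%N -> e u v -> v = next (w :: x :: p) u.
  move=> up vp uv; rewrite -{1}(nth_index w up) -{1}(nth_index w vp).
  have vs : (index v (x :: p) <= size p)%N by rewrite -index_mem in vp.
  move/(induced_path_nth ip uv vs) => iv.
  rewrite -[in RHS](nth_index w up) next_path; last by lia.
  by rewrite -iv nth_index.
move=> a b; rewrite [a \in _]inE [b \in _]inE.
case/orP=> [/eqP->|ap] /orP[/eqP->|bp] ab.
- by rewrite e_irr in ab.
- by case: (wadj _ bp ab) => ->; [left; rewrite next_w | right; rewrite next_last].
- rewrite e_sym in ab.
  by case: (wadj _ ap ab) => ->; [right; rewrite next_w | left; rewrite next_last].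
- have [iab|iba|iab] := ltngtP (index a (x :: p)) (index b (x :: p)).
  + by left; apply: key.
  + by right; apply: key; rewrite // e_sym.
  + have ab' : a = b by rewrite -(nth_index w ap) -(nth_index w bp) iab.
    by rewrite ab' e_irr in ab.
Qed.

(** * Connected sets and induced paths through them *)

Definition induced_rel (C : {set V}) : rel V :=
  [rel u v | [&& e u v, u \in C & v \in C]].

Definition connected_from (c : V) (C : {set V}) : Prop :=
  c \in C /\ forall a, a \in C -> connect (induced_rel C) c a.

Lemma connected_from_set1 c : connected_from c [set c].
Proof. by split=> [|a]; rewrite inE // => /eqP->; apply: connect0. Qed.

Lemma connected_from_setU1 c C d v : connected_from c C -> d \in C -> e d v ->
  connected_from c (v |: C).
Proof.
move=> [cC conC] dC dv.
have conC' a : a \in C -> connect (induced_rel (v |: C)) c a.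
  move/conC; apply: connect_sub => x y /and3P[xy xC yC].
  by apply: connect1; apply/and3P; rewrite xy !in_setU1 xC yC !orbT.
split=> [|a]; first by rewrite inE cC orbT.
rewrite inE => /orP[]; last exact: conC'.
rewrite inE => /eqP->; apply: connect_trans (conC' d dC) _.
by apply: connect1; apply/and3P; rewrite dv !in_setU1 dC eqxx orbT.
Qed.

(** A walk from [x] to [y] inside [C] is shortened to an induced path; it keeps an inner vertex
    because [x] and [y] are not adjacent. *)
Lemma induced_path_through c C x y a b : connected_from c C ->
  x \notin C -> y \notin C -> a \in C -> b \in C -> e x a -> e b y ->
  apart x y ->
  exists p, [/\ p != [::], {subset p <= C} & induced_path x (rcons p y)].
Proof.
move=> [_ conC] xC yC aC bC xa by_ /andP[xy nxy].
have eCsym : connect_sym (induced_rel C).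
  apply: sym_connect_sym => u v /=.
  by rewrite /induced_rel /= e_sym; case: (u \in C); case: (v \in C).
have : connect (induced_rel C) a b.
  by apply: connect_trans (conC b bC); rewrite eCsym; apply: conC.
case/connectP=> q qP bq.
have qC : {subset q <= C}.
  elim: q a {xa aC bq} qP => //= u q IHq a /andP[/and3P[_ _ uC] /IHq sq] z.
  by rewrite inE => /orP[/eqP->|/sq].
have : path e x (a :: rcons q y).
  rewrite /= xa rcons_path -bq by_ andbT.
  by apply: sub_path qP => u v /and3P[].
case/induced_subpath=> p [ip].
rewrite /= last_rcons; case/lastP: p ip => [|p z] ip /=.
  by move=> xeqy; rewrite xeqy eqxx in xy.
rewrite last_rcons => zy sp; rewrite {z}zy in ip sp.
exists p; split=> //.
- by apply: contraNneq nxy => p0; move: ip; rewrite p0 /= => /andP[].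
- move=> z zp; have := sp z; rewrite mem_rcons inE zp orbT => /(_ isT).
  have : z != y.
    move: (induced_path_uniq ip); rewrite /= rcons_uniq => /and3P[_ yp _].
    by apply: contraNneq yp => <-.
  by rewrite inE mem_rcons inE => /negPf-> /=; case/orP=> [/eqP->|/qC].
Qed.

Lemma adj_neq x y : e x y -> x != y.
Proof. by apply: contraTneq => ->; rewrite e_irr. Qed.

(** * Induced paths on three vertices that do not extend at both ends *)

Definition induced_P3 (U : {set V}) (a b c : V) : bool :=
  [&& a \in U, b \in U, c \in U & induced_path a [:: b; c]].

(** A path is avoidable when each of its induced extensions at both ends lies on a chordless cycle.
    Here such a cycle has length at least 6, so without long cycles avoidable means having no such
    extension. *)
Definition simplicial_P3 (U : {set V}) (a b c : V) : Prop :=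
  forall x y, x \in U -> y \in U -> ~~ induced_path x [:: a; b; c; y].

(** The complement of the closed neighbourhood of [C], since [apart] also excludes equality. *)
Definition far (C : {set V}) : {set V} := [set z | [forall c in C, apart c z]].

Lemma farP (C : {set V}) z : reflect (forall c, c \in C -> apart c z) (z \in far C).
Proof. by rewrite inE; apply: (iffP forall_inP). Qed.

Lemma farPn (C : {set V}) z : z \notin far C -> z \notin C -> exists2 c, c \in C & e c z.
Proof.
rewrite inE => /forall_inPn [c cC]; rewrite negb_and negbK => /orP[].
  by move=> /eqP<- /negP.
by rewrite negbK; exists c.
Qed.

Section NoLongCycles.
Hypothesis no_long_cycle : forall p, chordless_cycle e p -> (size p <= 5)%N.

(** Both [x] and [y] have neighbours in [C], so an induced path through [C] closes the five vertices
    to a chordless cycle of length at least 6. *)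
Lemma no_far_loop c C x y w1 w2 w3 : connected_from c C ->
  x \notin C -> y \notin C -> x \notin far C -> y \notin far C ->
  w1 \in far C -> w2 \in far C -> w3 \in far C ->
  ~~ induced_path x [:: w1; w2; w3; y].
Proof.
move=> conC xC yC /farPn /(_ xC) [a aC ax] /farPn /(_ yC) [b bC by_] f1 f2 f3.
apply/negP => /= /and4P[xw1 xnw1 /and4P[xw2 xw3 xy _] /and4P[w12 w12n /and3P[w13 w1y _]
  /and4P[w23 w23n /andP[w2y _] /and3P[w3y w3yn _]]]].
rewrite e_sym in ax.
have [p [p0 pC ip]] := induced_path_through conC xC yC aC bC ax by_ xy.
have apC w : w \in far C -> all (apart^~ w) p.
  by move/farP=> wC; apply/allP => z /pC /wC.
have ip3 : induced_path x (rcons (rcons p y) w3).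
  rewrite induced_path_rcons ip last_rcons belast_rcons /= e_sym w3y eq_sym w3yn.
  by rewrite xw3 apC.
have ip2 : induced_path x (rcons (rcons (rcons p y) w3) w2).
  rewrite induced_path_rcons ip3 !last_rcons !belast_rcons /= all_rcons.
  by rewrite e_sym w23 eq_sym w23n xw2 apC // apart_sym w2y.
have : chordless_cycle e (w1 :: x :: rcons (rcons (rcons p y) w3) w2).
  apply: close_induced_path => //.
  - by rewrite !size_rcons.
  - by rewrite e_sym.
  - by rewrite last_rcons e_sym.
  - by rewrite eq_sym.
  - by rewrite last_rcons.
  - rewrite belast_rcons /= !all_rcons w13 w1y /=.
    by apply/allP=> z /(allP (apC _ f1)); rewrite apart_sym.
move/no_long_cycle; rewrite /= !size_rcons.
by case: p p0 {pC ip apC ip3 ip2} => //= z p _; lia.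
Qed.

(* The contraction argument of Bonamy, Defrain, Hatzel and Thiebaut for avoidable
   paths, with a connected set [C] in place of the contracted vertex. *)
Lemma exists_simplicial_P3_aux n (U : {set V}) : (#|U| < n)%N ->
  (forall c (C : {set V}), C \subset U -> connected_from c C ->
    (exists w1 w2 w3, induced_P3 (U :&: far C) w1 w2 w3) ->
    exists w1 w2 w3, induced_P3 (U :&: far C) w1 w2 w3 /\ simplicial_P3 U w1 w2 w3)
  /\ ((exists w1 w2 w3, induced_P3 U w1 w2 w3) ->
    exists w1 w2 w3, induced_P3 U w1 w2 w3 /\ simplicial_P3 U w1 w2 w3).
Proof.
elim: n U => // n IHn U Un.
have part1 : forall c (C : {set V}), C \subset U -> connected_from c C ->
    (exists w1 w2 w3, induced_P3 (U :&: far C) w1 w2 w3) ->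
    exists w1 w2 w3, induced_P3 (U :&: far C) w1 w2 w3 /\ simplicial_P3 U w1 w2 w3.
  (* Inner induction: [C] absorbs adjacent vertices of [U] as long as an induced path on three
     vertices stays far from it. *)
  move=> c C; have [k] := ubnP #|U :\: C|; elim: k => // k IHk in C *.
  move=> Ck CU conC exP.
  have farS v : U :&: far (v |: C) \subset U :&: far C.
    apply/subsetP => z; rewrite !in_setI => /andP[-> /farP zf].
    by apply/farP => d dC; apply: zf; rewrite inE dC orbT.
  have P3S (U1 U2 : {set V}) w1 w2 w3 : U1 \subset U2 -> induced_P3 U1 w1 w2 w3 ->
      induced_P3 U2 w1 w2 w3.
    by move/subsetP=> sU /and4P[/sU h1 /sU h2 /sU h3 h]; apply/and4P.
  have [/existsP [v /and4P [vU vC vf /existsP [w1 /existsP [w2 /existsP [w3 P3w]]]]]|] :=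
    boolP [exists v, [&& v \in U, v \notin C, v \notin far C &
      [exists w1, exists w2, exists w3, induced_P3 (U :&: far (v |: C)) w1 w2 w3]]].
    have [d dC dv] := farPn vf vC.
    have [||||u1 [u2 [u3 [P3u simu]]]] := IHk (v |: C).
    - rewrite ltnS in Ck; apply: leq_trans Ck; apply: proper_card.
      apply/properP; split; first by apply: setDS; apply: subsetUr.
      by exists v; rewrite !inE ?vU ?vC // eqxx.
    - by rewrite subUset sub1set vU.
    - exact: connected_from_setU1 dv.
    - by exists w1, w2, w3.
    by exists u1, u2, u3; split=> //; apply: P3S P3u.
  move/existsPn => dom.
  (* For a maximal [C], the outer induction applies to [U :&: far C], which is smaller because it
     misses [c]. *)
  have [|_ basicH] := IHn (U :&: far C).
    rewrite ltnS in Un; apply: leq_trans Un; apply: proper_card.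
    apply/properP; split; first exact: subsetIl.
    case: conC => cC _; exists c; first exact: (subsetP CU).
    by apply/negP; rewrite inE => /andP[_ /farP/(_ c cC)]; rewrite /apart eqxx.
  have [w1 [w2 [w3 [P3w simw]]]] := basicH exP.
  exists w1, w2, w3; split=> // x y xU yU.
  have /and4P[] := P3w; rewrite !in_setI => /andP[w1U w1f] /andP[w2U w2f] /andP[w3U w3f] _.
  have notC x1 w : w \in far C -> e x1 w -> x1 \notin C.
    by move=> /farP wf xw; apply/negP=> /wf /andP[_]; rewrite xw.
  (* Maximality of [C]: a vertex of [U] adjacent to [C] cannot be apart from a whole induced path
     far from [C]. *)
  have hit v a1 a2 a3 : v \in U -> v \notin C -> v \notin far C ->
     induced_P3 (U :&: far C) a1 a2 a3 -> apart v a1 -> apart v a2 -> apart v a3 -> False.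
    move=> vU vC vf /and4P[]; rewrite !in_setI => /andP[a1U a1f] /andP[a2U a2f] /andP[a3U a3f] ip.
    move=> v1 v2 v3; move: (dom v); rewrite vU vC vf /=.
    move/negP; apply; apply/existsP; exists a1; apply/existsP; exists a2; apply/existsP; exists a3.
    have farU a : a \in far C -> apart v a -> a \in far (v |: C).
      move=> /farP af va; apply/farP => d; rewrite !inE => /orP[/eqP->//|/af//].
    by apply/and4P; split=> //; rewrite in_setI ?a1U ?a2U ?a3U farU.
  apply/negP => ip.
  have /= /and4P[xw1 xnw1 /and4P[xw2 xw3 xy _] /and4P[w12 w12n /and3P[w13 w1y _]
  /and4P[w23 w23n /andP[w2y _] /and3P[w3y w3yn _]]]] := ip.
  have xC := notC _ _ w1f xw1; have yC : y \notin C by apply: (notC _ w3) => //; rewrite e_sym.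
  (* If both ends are far, the choice of [w1 w2 w3] is contradicted. If only one is, [x w1 w2] or
     [w2 w3 y] is a far path missed by the other end. If neither is, there is a long cycle. *)
  have [xf|xf] := boolP (x \in far C); have [yf|yf] := boolP (y \in far C).
  - by move: (simw x y); rewrite !in_setI xU yU xf yf ip => /(_ isT isT).
  - apply: (hit y x w1 w2) => //; rewrite 1?apart_sym //.
    apply/and4P; split; rewrite ?in_setI ?xU ?w1U ?w2U ?xf ?w1f ?w2f //=.
    by rewrite xw1 xnw1 xw2 w12 w12n.
  - apply: (hit x w2 w3 y) => //.
    apply/and4P; split; rewrite ?in_setI ?yU ?w2U ?w3U ?yf ?w2f ?w3f //=.
    by rewrite w23 w23n w2y w3y w3yn.
  - by move: ip; apply/negP; apply: no_far_loop conC _ _ _ _ _ _ _.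
split=> // - [w1 [w2 [w3 P3w]]].
(* If some vertex [v] is apart from an induced path, the first part applies with [C = [set v]].
   Otherwise every path works: in an extension [x w1 w2 w3 y], the vertex [y] would be apart from
   [x w1 w2]. *)
have [/existsP[u1 /existsP[u2 /existsP [u3 /existsP[v /and4P [vU P3u v1 /andP [v2 v3]]]]]]|] :=
  boolP [exists u1, exists u2, exists u3, exists v, [&& v \in U, induced_P3 U u1 u2 u3,
    apart v u1 & apart v u2 && apart v u3]].
  have /and4P[u1U u2U u3U ip] := P3u.
  have fv u : apart v u -> u \in far [set v].
    by move=> vu; apply/farP => c; rewrite inE => /eqP->.
  have [|||a1 [a2 [a3 [P3a sima]]]] := part1 v [set v].
  - by rewrite sub1set.
  - exact: connected_from_set1.
  - by exists u1, u2, u3; apply/and4P; split=> //; rewrite in_setI ?u1U ?u2U ?u3U fv.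
  exists a1, a2, a3; split=> //.
  have /and4P[] := P3a; rewrite !in_setI => /andP[h1 _] /andP[h2 _] /andP[h3 _] h.
  by apply/and4P.
move=> nex; exists w1, w2, w3; split=> // x y xU yU; apply/negP => ip.
have /and4P[w1U w2U w3U ipw] := P3w.
have /= /and4P[xw1 xnw1 /and4P[xw2 xw3 xy _] /and4P[w12 w12n /and3P[w13 w1y _]
  /and4P[w23 w23n /andP[w2y _] /and3P[w3y w3yn _]]]] := ip.
move/negP: nex; apply; apply/existsP; exists x; apply/existsP; exists w1.
apply/existsP; exists w2; apply/existsP; exists y.
rewrite yU ![apart y _]apart_sym xy w1y w2y !andbT.
by rewrite /induced_P3 /= xU w1U w2U xw1 xnw1 xw2 w12 w12n.
Qed.

Hypothesis no_4_cycle : forall p, chordless_cycle e p -> size p != 4%N.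

(* The case [w1 = w3] is that of an edge whose end [w2] dominates the closed
   neighbourhood of [w1]: then the last condition says that no neighbour of
   [w1] lies outside the closed neighbourhood of [w2]. *)
Lemma exists_shedding_triple (U : {set V}) (a b : V) :
  a \in U -> b \in U -> e a b ->
  exists w1 w2 w3,
    [/\ [/\ w1 \in U, w2 \in U & w3 \in U], e w1 w2, e w3 w2, ~~ e w1 w3 &
      forall v1 v3, v1 \in U -> v3 \in U -> apart w2 v1 -> apart w2 v3 ->
        e w1 v1 -> e w3 v3 -> e v1 v3].
Proof.
move=> aU bU ab.
have [/existsP [u1 /existsP [u2 /existsP [u3 P3u]]]|] :=
    boolP [exists w1, exists w2, exists w3, induced_P3 U w1 w2 w3]; last first.
  (* The degenerate triple: a neighbour [v1] of [a] apart from [b] would give the induced path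
     [v1 a b]. *)
  move/existsPn => nP3; exists a, b, a; split=> //; first by rewrite e_irr.
  move=> v1 v3 v1U _ bv1 _ av1 _.
  have /existsPn/(_ a)/existsPn/(_ b)/negP[] := nP3 v1.
  rewrite /induced_P3 /= v1U aU bU ab ![_ v1 a]e_sym av1 (apart_sym v1) bv1 !andbT.
  by rewrite !adj_neq // e_sym.
have [_ basic] := exists_simplicial_P3_aux (ltnSn #|U|).
have [|w1 [w2 [w3 [P3w simw]]]] := basic; first by exists u1, u2, u3.
have /and4P[w1U w2U w3U /= /and4P[w12 w12n /andP[w13 _] /and3P[w23 w23n _]]] := P3w.
exists w1, w2, w3; split=> //; rewrite ?(e_sym w3) //; first by case/andP: w13.
(* The absence of 4-cycles keeps [v1] apart from [w3] and [v3] from [w1]; with [v1] and [v3]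
   nonadjacent, [v1 w1 w2 w3 v3] would then be an induced path. *)
have no4 v x y : apart x y -> e w2 x -> e w2 y -> apart w2 v -> e x v -> e y v -> False.
  move=> xy w2x w2y w2v xv yv.
  have /no_4_cycle : chordless_cycle e [:: w2; x; v; y]; last by [].
  apply: close_induced_path => //=.
  - by rewrite xv xy (e_sym v) yv /= !adj_neq // e_sym.
  - by rewrite e_sym.
  - exact: adj_neq.
  - exact: adj_neq.
  - by rewrite w2v.
move=> v1 v3 v1U v3U w2v1 w2v3 w1v1 w3v3; apply/negPn/negP => nv13.
have v1w3 : apart v1 w3.
  rewrite /apart; apply/andP; split.
    by apply: contraTneq w2v1 => ->; rewrite /apart w23 andbF.
  by apply/negP => v1w3; apply: (no4 v1 w1 w3) => //; rewrite e_sym.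
have v3w1 : apart v3 w1.
  rewrite /apart; apply/andP; split.
    by apply: contraTneq w2v3 => ->; rewrite /apart (e_sym w2) w12 andbF.
  by apply/negP => v3w1; apply: (no4 v3 w1 w3) => //; rewrite e_sym.
have := simw v1 v3 v1U v3U => /negP[] /=.
have v1v3 : apart v1 v3.
  rewrite /apart nv13 andbT.
  by apply: contraTneq w1v1 => ->; case/andP: v3w1; rewrite e_sym.
rewrite (e_sym v1) w1v1 w12 w12n w23 w23n w3v3 w13 w2v3 (apart_sym v1 w2) w2v1.
by rewrite v1w3 v1v3 (apart_sym w1) v3w1 !adj_neq // e_sym.
Qed.

End NoLongCycles.
End InducedPaths.

Local Open Scope ring_scope.

(** * Contraction and exterior multiplication on a basis of the exterior algebra *)

Section Exterior.
Variable s : nat.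
Local Notation I := 'I_s.

(** The sign $(-1)^b$, acting on a group without scalars. *)
Definition flip (V : zmodType) (b : bool) (x : V) : V := if b then - x else x.

Lemma flipD (V : zmodType) b : {morph @flip V b : x y / x + y}.
Proof. by move=> x y; case: b; rewrite /flip ?opprD. Qed.

Lemma flipN (V : zmodType) b : {morph @flip V b : x / - x}.
Proof. by move=> x; case: b. Qed.

Lemma flip0 (V : zmodType) b : flip b (0 : V) = 0.
Proof. by case: b; rewrite /flip ?oppr0. Qed.

Lemma flip_flip (V : zmodType) b c (x : V) : flip b (flip c x) = flip (b (+) c) x.
Proof. by case: b; case: c; rewrite /flip ?opprK. Qed.

Lemma flip_eq0 (V : zmodType) b (x : V) : (flip b x == 0) = (x == 0).
Proof. by case: b; rewrite /flip ?oppr_eq0. Qed.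

Lemma raddf_flip (V W : zmodType) (f : {additive V -> W}) b x :
  f (flip b x) = flip b (f x).
Proof. by case: b; rewrite /flip ?raddfN. Qed.

(** The sign exponent picked up when $e_t$ is moved to its sorted place in $e_T$. *)
Definition below (t : I) (T : {set I}) : bool := odd #|[set u in T | (u < t)%N]|.

Lemma belowU1 t u (T : {set I}) : u \notin T -> below t (u |: T) = (u < t)%N (+) below t T.
Proof.
move=> uT; rewrite /below; have [ut|tu] := boolP (u < t)%N.
  rewrite (_ : [set _ in _ | _] = u |: [set v in T | (v < t)%N]); last first.
    by apply/setP => v; rewrite !inE; case: eqVneq => [->|].
  by rewrite cardsU1 inE (negPf uT) addnC addn1.
congr (odd #|pred_of_set _|); apply/setP => v; rewrite !inE.
by case: eqVneq => [->|] //=; rewrite (negPf tu) (negPf uT).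
Qed.

Section Operators.
Variable V : zmodType.
Local Notation E := {ffun {set I} -> V}.

(** Elements are stored by their coefficients on the $e_T$, so removing [t] from a basis element
    means reading the coefficient at [t |: T]. *)
Definition contr (t : I) (u : E) : E :=
  [ffun T : {set I} => if t \in T then 0 else flip (below t T) (u (t |: T))].

Definition wedge (t : I) (u : E) : E :=
  [ffun T : {set I} => if t \in T then flip (below t (T :\ t)) (u (T :\ t)) else 0].

Lemma contr_is_additive t : additive (contr t).
Proof.
move=> u v; apply/ffunP => T; rewrite !ffunE.
by case: ifP; rewrite ?subr0 // flipD flipN.
Qed.
HB.instance Definition _ t := GRing.isZmodMorphism.Build E E (contr t) (contr_is_additive t).

Lemma wedge_is_additive t : additive (wedge t).
Proof.
move=> u v; apply/ffunP => T; rewrite !ffunE.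
by case: ifP; rewrite ?subr0 // flipD flipN.
Qed.
HB.instance Definition _ t := GRing.isZmodMorphism.Build E E (wedge t) (wedge_is_additive t).

Lemma contr_contr t t' u : contr t (contr t' u) = - contr t' (contr t u).
Proof.
apply/ffunP => T; rewrite !ffunE !in_setU1 (eq_sym t' t).
have [->|tt'] /= := eqVneq t t'; first by case: ifP; rewrite ?flip0 oppr0.
case: (boolP (t \in T)) => tT; case: (boolP (t' \in T)) => t'T;
  rewrite ?flip0 ?oppr0 //.
rewrite !flip_flip !belowU1 // setUCA -flipN.
have : (t < t')%N = ~~ (t' < t)%N by move: tt'; rewrite -val_eqE /=; lia.
move->; case: ltnP; case: (below t T); case: (below t' T); rewrite /flip /= ?opprK //.
Qed.

Lemma contr_id t u : contr t (contr t u) = 0.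
Proof. by apply/ffunP => T; rewrite !ffunE setU11 flip0 if_same. Qed.

(** The canonical anticommutation relation, from which the homotopy formulas below follow. *)
Lemma contr_wedge t t' u :
  contr t (wedge t' u) + wedge t' (contr t u) = if t == t' then u else 0.
Proof.
apply/ffunP => T; rewrite !ffunE !in_setU1 in_setD1 (eq_sym t' t).
have [->|tt'] /= := eqVneq t t'.
  case: (boolP (t' \in T)) => tT.
    by rewrite setD1K // add0r flip_flip addbb.
  by rewrite setU1K // addr0 flip_flip addbb.
rewrite ffunE; case: (boolP (t \in T)) => tT; case: (boolP (t' \in T)) => t'T;
  rewrite ?flip0 ?addr0 //.
have -> : (t |: T) :\ t' = t |: (T :\ t').
  by apply/setP => v; rewrite !inE; case: (eqVneq v t) => [->|//]; rewrite tt'.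
have {1}-> : T = t' |: (T :\ t') by rewrite setD1K.
rewrite !flip_flip !belowU1 ?in_setD1 ?eqxx ?andbF ?(negPf tT) ?andbF //.
have : (t < t')%N = ~~ (t' < t)%N by move: tt'; rewrite -val_eqE /=; lia.
move->; case: ltnP; case: (below t _); case: (below t' _); rewrite /flip /= ?subrr ?addNr //.
Qed.

Definition map_ext (f : V -> V) (u : E) : E := [ffun T => f (u T)].

Lemma map_ext_contr (f : {additive V -> V}) t u : map_ext f (contr t u) = contr t (map_ext f u).
Proof. by apply/ffunP => T; rewrite !ffunE; case: ifP; rewrite ?raddf0 ?raddf_flip. Qed.

Lemma map_ext_wedge (f : {additive V -> V}) t u : map_ext f (wedge t u) = wedge t (map_ext f u).
Proof. by apply/ffunP => T; rewrite !ffunE; case: ifP; rewrite ?raddf0 ?raddf_flip. Qed.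

Section Boundary.
Variable f : I -> {additive V -> V}.
Hypothesis f_comm : forall t t' x, f t (f t' x) = f t' (f t x).

(** One operator serves two complexes: multiplication by $x_t$ gives the Koszul differential, the
    identity gives the simplicial boundary. *)
Definition boundary (u : E) : E := \sum_t contr t (map_ext (f t) u).

Lemma boundary_is_additive : additive boundary.
Proof.
move=> u v; rewrite /boundary -sumrB; apply: eq_bigr => t _.
by rewrite -raddfB; congr contr; apply/ffunP => T; rewrite !ffunE raddfB.
Qed.
HB.instance Definition _ := GRing.isZmodMorphism.Build E E boundary boundary_is_additive.

Lemma boundaryE u T :
  boundary u T = \sum_(t | t \notin T) flip (below t T) (f t (u (t |: T))).
Proof.
rewrite /boundary sum_ffunE [RHS]big_mkcond; apply: eq_bigr => t _.
by rewrite !ffunE; case: (t \in T).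
Qed.

(** Contractions anticommute while the [f t] commute, so mixed terms cancel in pairs. The diagonal
    terms vanish by [contr_id]; antisymmetry would not give this in characteristic 2. *)
Lemma boundary_boundary u : boundary (boundary u) = 0.
Proof.
pose F t t' := contr t (contr t' (map_ext (f t) (map_ext (f t') u))).
have -> : boundary (boundary u) = \sum_t \sum_t' F t t'.
  apply: eq_bigr => t _; rewrite -raddf_sum; congr contr.
  have -> : boundary u = \sum_t' contr t' (map_ext (f t') u) by [].
  apply/ffunP => T; rewrite ffunE !sum_ffunE raddf_sum; apply: eq_bigr => t' _.
  by rewrite -[in RHS]map_ext_contr [RHS]ffunE.
have F0 t : F t t = 0 by rewrite /F contr_id.
have FC t t' : F t t' = - F t' t.
  rewrite /F contr_contr; congr (- contr _ (contr _ _)).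
  by apply/ffunP => T; rewrite !ffunE f_comm.
have split_sum : \sum_t \sum_t' F t t' =
    \sum_(t : I) \sum_(t' : I | (t < t')%N) F t t' +
    \sum_(t : I) \sum_(t' : I | (t' < t)%N) F t t'.
  rewrite -big_split; apply: eq_bigr => t _ /=.
  rewrite (bigID (fun t' : I => (t < t')%N)) /=; congr (_ + _).
  rewrite (bigD1 t) ?ltnn //= F0 add0r; apply: eq_bigl => t'.
  by rewrite -leqNgt andbC ltn_neqAle.
rewrite split_sum [X in _ + X](exchange_big_dep predT) //= -big_split big1 //= => t _.
by rewrite -big_split big1 //= => t' _; rewrite FC addNr.
Qed.

Lemma boundary_wedge t u :
  boundary (wedge t u) = map_ext (f t) u - wedge t (boundary u).
Proof.
apply/eqP; rewrite eq_sym subr_eq eq_sym; apply/eqP.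
rewrite {2}/boundary raddf_sum -big_split (bigD1 t) //= big1 ?addr0 => [|t' t't].
  by rewrite map_ext_wedge contr_wedge eqxx.
by rewrite map_ext_wedge contr_wedge (negPf t't).
Qed.

End Boundary.
End Operators.

Lemma map_ext_boundary (V W : zmodType) (f : I -> {additive V -> V})
    (f' : I -> {additive W -> W}) (g : {additive V -> W}) (u : {ffun {set I} -> V}) T :
  (forall t x, g (f t x) = f' t (g x)) ->
  g (boundary f u T) = boundary f' [ffun T' => g (u T')] T.
Proof.
move=> gf; rewrite !boundaryE raddf_sum; apply: eq_bigr => t _.
by rewrite ffunE raddf_flip gf.
Qed.

End Exterior.

(** * Coefficientwise operations on polynomials *)

Section Filter.
Variables (K : fieldType) (s : nat).
Local Notation S := {mpoly K[s]}.
Implicit Types (p q : S) (m : 'X_{1..s}) (P Q R : pred 'X_{1..s}).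

(** Used for homogeneous components, for setting a variable to zero, and for reduction modulo an
    ideal generated by variables. *)
Definition mfilter P p : S := \sum_(m <- msupp p | P m) p@_m *: 'X_[m].

Lemma mcoeff_filter P p m : (mfilter P p)@_m = if P m then p@_m else 0.
Proof.
rewrite /mfilter linear_sum /= big_mkcond /=.
rewrite (eq_bigr (fun i => if i == m then (if P m then p@_m else 0) else 0)); last first.
  move=> i _; case: eqVneq => [->|im]; case: (P _); rewrite // mcoeffZ mcoeffX.
    by rewrite eqxx mulr1.
  by rewrite (negPf im) mulr0.
rewrite -big_mkcond big_const_seq /=.
have [mp|mp] := boolP (m \in msupp p).
  by rewrite (count_uniq_mem m (msupp_uniq p)) mp /= addr0.
rewrite (count_memPn mp) /=; case: ifP => // _.
by apply/esym/eqP; rewrite mcoeff_eq0.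
Qed.

Lemma mfilter_is_additive P : additive (mfilter P).
Proof.
move=> p q; apply/mpolyP => m; rewrite mcoeffB !mcoeff_filter.
by case: ifP; rewrite ?mcoeffB ?subr0.
Qed.
HB.instance Definition _ P := GRing.isZmodMorphism.Build S S (mfilter P) (mfilter_is_additive P).

Lemma mfilter_id P p : {in msupp p, forall m, P m} -> mfilter P p = p.
Proof.
move=> pP; apply/mpolyP => m; rewrite mcoeff_filter.
have [/pP->//|mp] := boolP (m \in msupp p).
by move: mp; rewrite -mcoeff_eq0 => /eqP->; rewrite if_same.
Qed.

Lemma mfilterM P Q R p q :
  (forall m1 m2, m1 \in msupp p -> m2 \in msupp q -> R (m1 + m2)%MM = P m1 && Q m2) ->
  mfilter R (p * q) = mfilter P p * mfilter Q q.
Proof.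
move=> RPQ; apply/mpolyP => m; rewrite mcoeff_filter.
rewrite (mcoeffM (mfilter P p)) (mcoeffM p q).
have -> : (if R m then \sum_(k : 'X_{1..s < (mdeg m).+1, (mdeg m).+1} | m == (k.1 + k.2)%MM)
    p@_k.1 * q@_k.2 else 0) =
  \sum_(k : 'X_{1..s < (mdeg m).+1, (mdeg m).+1} | m == (k.1 + k.2)%MM)
    if R m then p@_k.1 * q@_k.2 else 0.
  by case: (R m) => //; rewrite big1.
apply: eq_bigr => k /eqP mk; rewrite !mcoeff_filter.
have [k1|] := boolP ((k.1 : 'X_{1..s}) \in msupp p); last first.
  by rewrite -mcoeff_eq0 => /eqP->; rewrite mul0r !if_same mul0r.
have [k2|] := boolP ((k.2 : 'X_{1..s}) \in msupp q); last first.
  by rewrite -mcoeff_eq0 => /eqP->; rewrite mulr0 !if_same mulr0.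
have -> : R m = P k.1 && Q k.2 by rewrite -RPQ //; congr R.
case: (P _); case: (Q _); rewrite /= ?mul0r ?mulr0 //.
Qed.

(** Subtraction of exponents is truncated, so the terms not divisible by $x_t$ have to be
    dropped. *)
Definition mdivX (t : 'I_s) p : S :=
  \sum_(m <- msupp p | (0 < m t)%N) p@_m *: 'X_[m - U_(t)].

Lemma mnm_subU_eq (t : 'I_s) m m' : (0 < m t)%N ->
  ((m - U_(t))%MM == m') = (m == (m' + U_(t))%MM).
Proof.
move=> mt; have Um : (U_(t) <= m)%MM by rewrite lep1mP -lt0n.
by apply/eqP/eqP => [<-|->]; rewrite ?submK // addmK.
Qed.

Lemma mcoeff_divX t p m : (mdivX t p)@_m = p@_(m + U_(t)).
Proof.
rewrite /mdivX linear_sum /= big_mkcond /=.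
rewrite (eq_bigr (fun i => if i == (m + U_(t))%MM then p@_(m + U_(t)) else 0)); last first.
  move=> i _; have [i0|] := ltnP 0 (i t).
    rewrite mcoeffZ mcoeffX mnm_subU_eq //.
    by case: eqVneq => [->|_]; rewrite ?mulr1 ?mulr0.
  rewrite leqn0 => /eqP i0; case: eqVneq => // im.
  by move: i0; rewrite im mnmDE mnm1E eqxx addn1.
rewrite -big_mkcond big_const_seq /=.
have [mp|mp] := boolP ((m + U_(t))%MM \in msupp p).
  by rewrite (count_uniq_mem _ (msupp_uniq p)) mp /= addr0.
by rewrite (count_memPn mp) /=; apply/esym/eqP; rewrite mcoeff_eq0.
Qed.

Lemma mdivX_is_additive t : additive (mdivX t).
Proof. by move=> p q; apply/mpolyP => m; rewrite mcoeffB !mcoeff_divX mcoeffB. Qed.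
HB.instance Definition _ t := GRing.isZmodMorphism.Build S S (mdivX t) (mdivX_is_additive t).

Lemma mcoeff_mulX (t : 'I_s) p m :
  ('X_t * p)@_m = if (0 < m t)%N then p@_(m - U_(t)) else 0.
Proof.
rewrite mulrC; case: ifP => mt.
  by rewrite -{1}(@submK _ U_(t)%MM m) ?lep1mP -?lt0n // addmC mcoeffMX.
apply/eqP; rewrite mcoeff_eq0; apply: contraFN mt => /msuppM_le /allpairsP [[m1 m2] /= [_]].
by rewrite msuppX inE => /eqP-> ->; rewrite mnmDE mnm1E eqxx addn1.
Qed.

Definition msetX0 (t : 'I_s) : S -> S := mfilter (fun m => m t == 0%N).

Lemma mdivX_split t p : p = msetX0 t p + 'X_t * mdivX t p.
Proof.
apply/mpolyP => m; rewrite mcoeffD mcoeff_filter mcoeff_mulX lt0n.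
case: eqVneq => [_|mt] /=; rewrite ?addr0 // add0r mcoeff_divX submK //.
by rewrite lep1mP.
Qed.

Lemma mdivX_mulX t p : mdivX t ('X_t * p) = p.
Proof.
by apply/mpolyP => m; rewrite mcoeff_divX mulrC [X in _@_X]addmC mcoeffMX.
Qed.

Lemma mdivX_mulX_neq t t' p : t != t' -> mdivX t ('X_t' * p) = 'X_t' * mdivX t p.
Proof.
move=> tt'; apply/mpolyP => m; rewrite mcoeff_divX !mcoeff_mulX mcoeff_divX.
rewrite mnmDE mnm1E (negPf tt') addn0; case: ifP => // mt'; congr (_@__).
by rewrite addmC -addmBA ?lep1mP -?lt0n // addmC.
Qed.

Lemma homogeneous_filter (d : int) p :
  homogeneous d (mfilter (fun m => (mdeg m)%:Z == d) p).
Proof.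
move=> m; rewrite mcoeff_msupp mcoeff_filter.
by case: ifP => [/eqP//|_]; rewrite eqxx.
Qed.

Lemma homogeneous0 (d : int) : homogeneous d (0 : S).
Proof. by move=> m; rewrite msupp0. Qed.

Lemma homogeneousD (d : int) p q : homogeneous d p -> homogeneous d q -> homogeneous d (p + q).
Proof. by move=> hp hq m /msuppD_le; rewrite mem_cat => /orP[/hp|/hq]. Qed.

Lemma homogeneousN (d : int) p : homogeneous d p -> homogeneous d (- p).
Proof. by move=> hp m; rewrite (perm_mem (msuppN _)) => /hp. Qed.

Lemma homogeneousM (d d' : int) p q : homogeneous d p -> homogeneous d' q ->
  homogeneous (d + d') (p * q).
Proof.
move=> hp hq m /msuppM_le /allpairsP [[m1 m2] /= [/hp h1 /hq h2 ->]].
by rewrite mdegD PoszD h1 h2.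
Qed.

Lemma homogeneous_sum (d : int) (J : finType) (A : pred J) (F : J -> S) :
  (forall i, A i -> homogeneous d (F i)) -> homogeneous d (\sum_(i | A i) F i).
Proof. by move=> hF; elim/big_ind: _ => //; [exact: homogeneous0 | exact: homogeneousD]. Qed.

Lemma homogeneousX m : homogeneous (mdeg m)%:Z ('X_[m] : S).
Proof. by move=> m'; rewrite msuppX inE => /eqP->. Qed.

Lemma filter_homogeneousM (d d' : int) p q : homogeneous d' q ->
  mfilter (fun m => (mdeg m)%:Z == d + d') (p * q) =
  mfilter (fun m => (mdeg m)%:Z == d) p * q.
Proof.
move=> hq; rewrite -[in RHS](@mfilter_id predT q) //; apply: mfilterM => m1 m2 _ /hq <-.
by rewrite andbT mdegD PoszD (inj_eq (addIr _)).
Qed.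

Lemma filter_homogeneous (d : int) p : homogeneous d p ->
  mfilter (fun m => (mdeg m)%:Z == d) p = p.
Proof. by move=> hp; apply: mfilter_id => m /hp ->. Qed.

End Filter.

(** * Koszul complexes and graded free resolutions *)

Section Koszul.
Variables (K : fieldType) (s : nat).
Local Notation S := {mpoly K[s]}.
Local Notation I := 'I_s.

Section Acyclicity.
Variable n : nat.
Local Notation M := 'rV[S]_n.
Implicit Types u y w : {ffun {set I} -> M}.

Definition mulX (t : I) : {additive M -> M} := GRing.scale ('X_t : S).

Lemma mulX_comm t t' x : mulX t (mulX t' x) = mulX t' (mulX t x).
Proof. by rewrite /= !scalerA mulrC. Qed.

Definition koszul : {ffun {set I} -> M} -> {ffun {set I} -> M} := boundary mulX.
HB.instance Definition _ := GRing.Additive.on koszul.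

Lemma koszul_koszul u : koszul (koszul u) = 0.
Proof. exact: boundary_boundary mulX_comm u. Qed.

Lemma contr_wedge_proj t u T : contr t (wedge t u) T = if t \in T then 0 else u T.
Proof.
rewrite !ffunE; case: ifP => // tT.
by rewrite setU11 setU1K ?tT // flip_flip addbb.
Qed.

(* The homotopy is [wedge t] composed with division by [x_t]. *)
Lemma koszul_homotopy t u : koszul u = 0 ->
  u = contr t (wedge t (map_ext (map_mx (@msetX0 K s t)) u))
      + koszul (wedge t (map_ext (map_mx (@mdivX K s t)) u)).
Proof.
move=> ku0; rewrite /koszul boundary_wedge.
set u0 := map_ext (map_mx (@msetX0 K s t)) u.
set u1 := map_ext (map_mx (@mdivX K s t)) u.
have split_u : u = u0 + map_ext (mulX t) u1.
  apply/ffunP => T; rewrite !ffunE; apply/rowP => k; rewrite !mxE.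
  exact: mdivX_split.
(* Division of [koszul u = 0] by $x_t$ turns its [t]-th term into [contr t u] and replaces [u] by
   [u1] in the others. The [t]-th term of the boundary of [u1] is [contr t (u - u0)]. *)
have -> : boundary mulX u1 = - contr t u0.
  rewrite /boundary (bigD1 t) //= (_ : map_ext _ u1 = u - u0); last first.
    by rewrite split_u [u0 + _]addrC addrK.
  rewrite raddfB /=.
  have : map_ext (map_mx (@mdivX K s t)) (koszul u) = 0.
    by rewrite ku0; apply/ffunP => T; rewrite !ffunE; apply: raddf0.
  rewrite /koszul /boundary (bigD1 t) //= => Hk.
  have {}Hk : contr t u + \sum_(t' | t' != t) contr t' (map_ext (mulX t') u1) = 0.
    rewrite -[RHS]Hk; apply/ffunP => T; rewrite !ffunE !sum_ffunE raddfD /=.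
    congr (_ + _).
      rewrite ?ffunE; case: ifP => _; first by rewrite raddf0.
      rewrite raddf_flip /=; congr flip; rewrite ?ffunE; apply/rowP => k.
      by rewrite !mxE mdivX_mulX.
    rewrite raddf_sum; apply: eq_bigr => t' t't.
    rewrite ?ffunE; case: ifP => _; first by rewrite raddf0.
    rewrite raddf_flip /=; congr flip; rewrite ?ffunE; apply/rowP => k.
    by rewrite !mxE mdivX_mulX_neq // eq_sym.
  by rewrite addrAC Hk sub0r.
rewrite raddfN opprK [LHS]split_u addrCA [contr _ _ + _]contr_wedge eqxx addrC.
by [].
Qed.

(** The homotopies are applied for one variable after another: modulo boundaries, neither $e_t$ nor
    $x_t$ occurs for [t] in [ts], and the constant terms at the empty set are kept. *)
Lemma koszul_reduce (ts : seq I) u : koszul u = 0 ->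
  exists y w, [/\ u = w + koszul y, koszul w = 0,
    forall t (T : {set I}), t \in ts -> t \in T -> w T = 0,
    forall t (T : {set I}) k m, t \in ts -> (w T 0 k)@_m != 0 -> m t = 0%N &
    forall k, (w set0 0 k)@_0 = (u set0 0 k)@_0].
Proof.
move=> ku0; elim: ts => [|t ts [y [w [uE kw w0 wm wc]]]].
  by exists 0, u; split=> //; rewrite [koszul 0]raddf0 addr0.
pose w' := contr t (wedge t (map_ext (map_mx (@msetX0 K s t)) w)).
have w'E T : w' T = if t \in T then 0 else map_mx (@msetX0 K s t) (w T).
  by rewrite contr_wedge_proj ffunE.
have wE := koszul_homotopy t kw; rewrite -/w' in wE.
exists (y + wedge t (map_ext (map_mx (@mdivX K s t)) w)), w'; split.
- by rewrite [koszul (_ + _)]raddfD {1}uE {1}wE addrA addrAC.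
- move: kw; rewrite {1}wE [koszul (_ + _)]raddfD.
  by rewrite /= koszul_koszul addr0.
- move=> t' T; rewrite w'E inE => /orP[/eqP->->//|t'ts t'T].
  by case: ifP => // _; rewrite (w0 t') // raddf0.
- move=> t' T k m t'ts; rewrite w'E; case: ifP => _; first by rewrite mxE mcoeff0 eqxx.
  rewrite mxE mcoeff_filter; case: (eqVneq (m t) 0%N) => [mt|_]; last by rewrite eqxx.
  by move: t'ts; rewrite inE => /orP[/eqP->//|t'ts]; apply: wm.
- by move=> k; rewrite -wc w'E inE mxE mcoeff_filter mnm0E eqxx.
Qed.

(** Once all variables are eliminated, only the constant terms at the empty set can survive. *)
Lemma koszul_exact u : koszul u = 0 -> (forall k, (u set0 0 k)@_0 = 0) ->
  exists y, u = koszul y.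
Proof.
move=> ku0 uc; have [y [w [uE _ w0 wm wc]]] := koszul_reduce (enum I) ku0.
exists y; rewrite uE (_ : w = 0) ?add0r //; apply/ffunP => T; rewrite ffunE.
have [->|[t tT]] := set_0Vmem T; last by rewrite (w0 t) ?mem_enum.
apply/rowP => k; rewrite mxE; apply/mpolyP => m; rewrite mcoeff0; apply/eqP.
apply/negPn/negP => wkm; have m0 : m = 0%MM.
  by apply/mnmP => t; rewrite mnm0E (wm t set0 k m) // mem_enum.
by move: wkm; rewrite m0 wc uc eqxx.
Qed.

Definition layer (i : nat) u : {ffun {set I} -> M} :=
  [ffun T : {set I} => if #|T| == i then u T else 0].

Lemma koszulE u T :
  koszul u T = \sum_(t | t \notin T) flip (below t T) ('X_t *: u (t |: T)).
Proof. exact: boundaryE. Qed.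

Lemma koszul_layer i u : koszul (layer i.+1 u) = layer i (koszul u).
Proof.
apply/ffunP => T; rewrite ffunE !koszulE; case: ifP => Ti; last first.
  by apply: big1 => t tT; rewrite ffunE cardsU1 tT add1n eqSS Ti scaler0 flip0.
by apply: eq_bigr => t tT; rewrite ffunE cardsU1 tT add1n eqSS Ti.
Qed.

End Acyclicity.

Lemma koszul_mulmx n n' (A : 'M[S]_(n, n')) (u : {ffun {set I} -> 'rV[S]_n}) T :
  koszul u T *m A = koszul [ffun T' => u T' *m A] T.
Proof.
apply: (map_ext_boundary (f := @mulX n) (f' := @mulX n') (g := mulmxr A)) => t x.
by rewrite /= scalemxAl.
Qed.

Lemma koszul_homogeneous n (d : int) (sh : 'I_n -> int) (u : {ffun {set I} -> 'rV[S]_n}) :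
  (forall T k, homogeneous (d - sh k) (u T 0 k)) ->
  forall T k, homogeneous (d + 1 - sh k) (koszul u T 0 k).
Proof.
move=> hu T k; rewrite koszulE summxE; apply: homogeneous_sum => t _.
have : homogeneous (d + 1 - sh k) (('X_t *: u (t |: T)) 0 k).
  rewrite mxE (_ : d + 1 - sh k = 1 + (d - sh k)); last by ring.
  apply: homogeneousM => //.
  have -> : 1 = (mdeg U_(t)%MM)%:Z by rewrite mdeg1.
  exact: homogeneousX.
by rewrite /flip; case: ifP => // _ h; rewrite mxE; apply: homogeneousN.
Qed.

Section Resolution.
Variables (J : S -> Prop) (F : min_graded_free_resolution J) (r : int).
Hypothesis shift_le : forall q (k : 'I_(rank F q)), shift k <= r + q%:Z.

(* [Tor_i(M_q, K)] vanishes in degree [d + i] for [d > r + q], where [M_q] is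
   the image of [F_q]: dimension shifting along the resolution. *)
Lemma koszul_cycle_boundary i q (d : int) (u : {ffun {set I} -> 'rV[S]_(rank F q)}) :
  r + q%:Z < d ->
  (forall T k, homogeneous (d - shift k) (u T 0 k)) ->
  (forall T : {set I}, #|T| != i -> u T = 0) ->
  (forall T, exists w, koszul u T = w *m diff F q) ->
  exists y, forall T, exists w, u T - koszul y T = w *m diff F q.
Proof.
elim: i q d u => [|i IHi] q d u dgt hu ui ku.
  (* Only [u set0] can be nonzero, and its entries have positive degrees [d - shift k], hence no
     constant terms. *)
  have [||y uE] := @koszul_exact _ u.
  - apply/ffunP => T; rewrite koszulE ffunE big1 // => t tT.
    by rewrite ui ?scaler0 ?flip0 // cardsU1 tT.
  - move=> k; apply/eqP; rewrite mcoeff_eq0; apply/negP => /hu.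
    by rewrite mdeg0; have := shift_le k; lia.
  by exists y => T; exists 0; rewrite -uE subrr mul0mx.
have [u' u'E] := fin_all_exists ku.
(* The lift of [koszul u] to the next module is cut down to Koszul degree [i] and internal degree
   [d + 1], as the induction hypothesis requires. *)
pose u2 : {ffun {set I} -> 'rV[S]_(rank F q.+1)} :=
  layer i [ffun T => \row_l mfilter (fun m => (mdeg m)%:Z == d + 1 - shift l) (u' T 0 l)].
have u2E T : u2 T *m diff F q = koszul u T.
  rewrite !ffunE; case: ifP => Ti; last first.
    rewrite mul0mx koszulE big1 // => t tT.
    by rewrite ui ?scaler0 ?flip0 // cardsU1 tT add1n eqSS Ti.
  apply/rowP => k; rewrite -(filter_homogeneous (koszul_homogeneous hu (T := T) (k := k))).
  rewrite u'E !mxE raddf_sum; apply: eq_bigr => l _; rewrite mxE /=.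
  have -> : d + 1 - shift k = (d + 1 - shift l) + (shift l - shift k) by ring.
  by rewrite filter_homogeneousM //; apply: diff_graded.
have u2_lift : [ffun T => u2 T *m diff F q] = koszul u.
  by apply/ffunP => T; rewrite ffunE u2E.
have [||||y' y'E] := IHi q.+1 (d + 1) u2.
- by lia.
- move=> T k; rewrite !ffunE; case: ifP => _; rewrite mxE.
    exact: homogeneous_filter.
  exact: homogeneous0.
- by move=> T /negPf Ti; rewrite ffunE Ti.
- move=> T; apply/diff_exact; rewrite koszul_mulmx u2_lift.
  by rewrite koszul_koszul ffunE.
(* This correction by an image of [diff F q] makes [u] an actual Koszul cycle, whose part in degree
   [i.+1] bounds. *)
pose v := u - [ffun T => y' T *m diff F q].
have kv : koszul v = 0.
  rewrite [koszul v]raddfB; apply/ffunP => T; rewrite 3!ffunE -u2E -koszul_mulmx -mulmxBl.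
  exact/diff_exact.
have [||y vE] := @koszul_exact _ (layer i.+1 v).
- by rewrite koszul_layer kv; apply/ffunP => T; rewrite !ffunE if_same.
- by move=> k; rewrite ffunE cards0 mxE mcoeff0.
exists y => T; rewrite -vE ffunE; case: ifP => Ti.
  by exists (y' T); rewrite !ffunE opprB addrC subrK.
by exists 0; rewrite ui ?Ti // subrr mul0mx.
Qed.

End Resolution.
End Koszul.

(** * Adjointness, the simplicial boundary and the signs of complements *)

Section Signs.
Variable s : nat.
Local Notation I := 'I_s.

(** Contraction and exterior multiplication are adjoint when the sets form an orthonormal basis:
    reindex by [R] to [t |: R]. *)
Lemma sum_mul_wedge (K : fieldType) (t : I) (psi y : {ffun {set I} -> K}) :
  \sum_R psi R * wedge t y R = \sum_R contr t psi R * y R.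
Proof.
rewrite (bigID (fun R : {set I} => t \in R)) /= [X in _ + X]big1 ?addr0; last first.
  by move=> R /negPf tR; rewrite ffunE tR mulr0.
rewrite [RHS](bigID (fun R : {set I} => t \in R)) /= [X in _ = X + _]big1 ?add0r; last first.
  by move=> R tR; rewrite ffunE tR mul0r.
rewrite (reindex_onto (fun R => t |: R) (fun R => R :\ t)) /=; last first.
  by move=> R tR; rewrite setD1K.
have tU (R : {set I}) : (t \in t |: R) && ((t |: R) :\ t == R) = (t \notin R).
  rewrite setU11 /=; apply/eqP/idP => [<-|tR]; first by rewrite !inE eqxx.
  by rewrite setU1K.
rewrite (eq_bigl _ _ tU); apply: eq_bigr => R tR.
rewrite !ffunE setU11 (negPf tR) setU1K // /flip.
by case: ifP; rewrite ?mulNr ?mulrN.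
Qed.

(** The boundary of the augmented chain complex of the full simplex; the empty set counts as a
    face. *)
Definition simplicial_boundary (V : zmodType) : {ffun {set I} -> V} -> {ffun {set I} -> V} :=
  boundary (fun _ => idfun : {additive V -> V}).
HB.instance Definition _ V := GRing.Additive.on (@simplicial_boundary V).

Lemma simplicial_boundaryE (V : zmodType) (u : {ffun {set I} -> V}) :
  simplicial_boundary u = \sum_t contr t u.
Proof.
apply: eq_bigr => t _; congr contr.
by apply/ffunP => T; rewrite ffunE.
Qed.

Lemma simplicial_boundary_wedge (V : zmodType) t (u : {ffun {set I} -> V}) :
  simplicial_boundary (wedge t u) = u - wedge t (simplicial_boundary u).
Proof.
rewrite [LHS]boundary_wedge; congr (_ - _).
by apply/ffunP => T; rewrite ffunE.
Qed.

Lemma simplicial_boundary_boundary (V : zmodType) (u : {ffun {set I} -> V}) :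
  simplicial_boundary (simplicial_boundary u) = 0.
Proof. exact: boundary_boundary. Qed.

Lemma below_split t (W R : {set I}) : R \subset W -> t \in R ->
  below t W = below t (W :\: R) (+) below t (R :\ t).
Proof.
move=> RW tR; rewrite /below -oddD; congr (odd _).
rewrite -[in LHS](cardsID R) addnC; congr (_ + _)%N; apply: eq_card => u; rewrite !inE.
  by rewrite andbA.
have [->|ut] := eqVneq u t; first by rewrite ltnn !andbF.
have [uR|uR] := boolP (u \in R); last by rewrite !andbF.
by rewrite (subsetP RW) // !andbT.
Qed.

(* [prod_(t in T) (-1)^(below t W)]: it turns the signs of subsets of [W] into
   those of their complements in [W]. *)
Definition parity (W T : {set I}) : bool := odd #|[set t in T | below t W]|.

Lemma parity_setD1 (W R : {set I}) t : R \subset W -> t \in R ->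
  parity W (W :\: (R :\ t)) = below t W (+) parity W (W :\: R).
Proof.
move=> RW tR; rewrite /parity.
have tW := subsetP RW t tR.
have [bt|bt] := boolP (below t W).
  rewrite (_ : [set _ in _ | _] = t |: [set u in W :\: R | below u W]).
    by rewrite cardsU1 !inE tR add1n.
  by apply/setP => u; rewrite !inE; case: eqVneq => [->|//]; rewrite tW.
rewrite (_ : [set _ in _ | _] = [set u in W :\: R | below u W]) //.
by apply/setP => u; rewrite !inE; case: eqVneq => [->|//]; rewrite (negPf bt) !andbF.
Qed.

End Signs.

(** * Edge ideals *)

Section EdgeIdeal.
Variables (K : fieldType) (s : nat) (e : rel 'I_s).
Hypotheses (e_sym : symmetric e) (e_irr : irreflexive e).
Local Notation S := {mpoly K[s]}.
Local Notation I := 'I_s.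
Local Notation J := (@edge_ideal K s e).

Definition has_edge (m : 'X_{1..s}) : bool :=
  [exists i, exists j, [&& e i j, (0 < m i)%N & (0 < m j)%N]].

Lemma has_edgeP (m : 'X_{1..s}) :
  reflect (exists i j, [/\ e i j, (0 < m i)%N & (0 < m j)%N]) (has_edge m).
Proof.
apply: (iffP existsP) => [[i /existsP [j /and3P]]|[i [j /and3P h]]]; first by exists i, j.
by exists i; apply/existsP; exists j.
Qed.

Lemma has_edgeD m m' : has_edge m -> has_edge (m' + m)%MM.
Proof.
case/has_edgeP=> i [j [eij mi mj]]; apply/has_edgeP; exists i, j.
by rewrite eij !mnmDE; split=> //; lia.
Qed.

(** Membership in a monomial ideal is decided term by term: every term of a combination of
    generators is divisible by one of them, and conversely each such term is a multiple of a
    generator. *)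
Lemma edge_idealP (p : S) : J p <-> {in msupp p, forall m, has_edge m}.
Proof.
split=> [[n [a [h [hE ->]]]] m|pE].
  rewrite mcoeff_msupp linear_sum /= => /eqP nz.
  have /existsP [k nzk] : [exists k, (a k * h k)@_m != 0].
    apply: contra_notT nz; rewrite negb_exists => /forallP z.
    by apply: big1 => k _; apply/eqP; rewrite -[_ == _]negbK.
  move: nzk; rewrite -mcoeff_msupp => /msuppM_le /allpairsP [[m1 m2] /= [_ m2h ->]].
  apply: has_edgeD; have [i [j [eij hij]]] := hE k.
  move: m2h; rewrite hij -mpolyXD msuppX inE => /eqP->.
  by apply/has_edgeP; exists i, j; rewrite !mnmDE !mnm1E !eqxx; split=> //; lia.
pose ms : seq 'X_{1..s} := msupp p.
have mono (k : 'I_(size ms)) : exists a h, (exists i j, e i j /\ h = 'X_i * 'X_j :> S)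
    /\ p@_(nth 0%MM ms k) *: 'X_[nth 0%MM ms k] = a * h.
  have : has_edge (nth 0%MM ms k) by apply: pE; apply: mem_nth.
  case/has_edgeP => i [j [eij mi mj]].
  exists (p@_(nth 0%MM ms k) *: 'X_[nth 0%MM ms k - (U_(i) + U_(j))]), ('X_i * 'X_j).
  split; first by exists i, j.
  rewrite -scalerAl -!mpolyXD submK //; apply/mnm_lepP => l; rewrite mnmDE !mnm1E.
  (* As [i] and [j] differ, positive exponents at both suffice for divisibility by $x_i x_j$. *)
  have ij : i != j by apply: contraTneq eij => ->; rewrite e_irr.
  case: (eqVneq i l) ij => [<-|_] ij; first by rewrite eq_sym (negPf ij) addn0.
  by case: (eqVneq j l) => [<-|].
have [a aP] := fin_all_exists mono; have [h hP] := fin_all_exists aP.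
exists (size ms), a, h; split=> [k|]; first by case: (hP k).
rewrite [LHS]mpolyE (big_nth 0%MM) big_mkord; apply: eq_bigr => k _.
by case: (hP k).
Qed.

Lemma edge_ideal0 : J 0.
Proof. by apply/edge_idealP => m; rewrite msupp0. Qed.

Lemma edge_idealD p q : J p -> J q -> J (p + q).
Proof.
move=> /edge_idealP hp /edge_idealP hq; apply/edge_idealP => m /msuppD_le.
by rewrite mem_cat => /orP[/hp|/hq].
Qed.

Lemma edge_idealM a p : J p -> J (a * p).
Proof.
move=> /edge_idealP hp; apply/edge_idealP => m /msuppM_le /allpairsP [[m1 m2] /= [_ /hp h ->]].
exact: has_edgeD.
Qed.

Lemma edge_idealN p : J p -> J (- p).
Proof. by rewrite -mulN1r; apply: edge_idealM. Qed.

Lemma edge_ideal_filter (P : pred 'X_{1..s}) p : J p -> J (mfilter P p).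
Proof.
move=> /edge_idealP hp; apply/edge_idealP => m; rewrite mcoeff_msupp mcoeff_filter.
by case: ifP => _; rewrite ?eqxx // -mcoeff_msupp => /hp.
Qed.

Definition mset (R : {set I}) : 'X_{1..s} := [multinom (i \in R : nat) | i < s].

Lemma msetE R i : mset R i = (i \in R).
Proof. by rewrite mnmE. Qed.

Lemma mdeg_mset R : mdeg (mset R) = #|R|.
Proof.
rewrite mdegE -sum1_card [RHS]big_mkcond; apply: eq_bigr => i _.
by rewrite msetE; case: (i \in R).
Qed.

Lemma mset_setD1 (R : {set I}) t : t \in R -> (mset R - U_(t))%MM = mset (R :\ t).
Proof.
move=> tR; apply/mnmP => i; rewrite mnmBE mnm1E !msetE in_setD1 (eq_sym t).
by case: eqVneq => [->|]; rewrite ?tR ?subn0.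
Qed.

Definition independent (R : {set I}) : Prop := forall x y, x \in R -> y \in R -> ~~ e x y.

Lemma has_edge_mset R : independent R -> ~~ has_edge (mset R).
Proof.
move=> iR; apply/has_edgeP => -[i [j [eij]]]; rewrite !msetE !lt0b => iR' jR'.
by move: (iR i j iR' jR'); rewrite eij.
Qed.

(** * The upper bound on the v-number *)

Section VNumber.
Variable sigma : {set I}.
Hypothesis sigma_indep : independent sigma.
Hypothesis sigma_cover :
  forall x y, e x y -> exists2 z, z \in sigma & e z x \/ e z y.

Definition meets_nbhd (m : 'X_{1..s}) : bool :=
  [exists z in sigma, exists i, e z i && (0 < m i)%N].

Lemma meets_nbhdP (m : 'X_{1..s}) :
  reflect (exists z i, [/\ z \in sigma, e z i & (0 < m i)%N]) (meets_nbhd m).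
Proof.
apply: (iffP exists_inP) => [[z zs /existsP [i /andP[zi mi]]]|[z [i [zs zi mi]]]].
  by exists z, i.
by exists z => //; apply/existsP; exists i; rewrite zi.
Qed.

Lemma meets_nbhdD m m' : meets_nbhd (m + m')%MM = meets_nbhd m || meets_nbhd m'.
Proof.
apply/meets_nbhdP/orP => [[z [i [zs zi]]]|].
  rewrite mnmDE addn_gt0 => /orP[mi|mi]; [left|right]; apply/meets_nbhdP;
  by exists z, i.
case=> /meets_nbhdP [z [i [zs zi mi]]]; exists z, i; rewrite mnmDE addn_gt0 mi ?orbT;
by split.
Qed.

(** Every edge has an end adjacent to [sigma]; by independence that end is outside [sigma], so its
    variable must come from [m]. *)
Lemma has_edge_sigma (m : 'X_{1..s}) : has_edge (mset sigma + m)%MM = meets_nbhd m.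
Proof.
apply/has_edgeP/meets_nbhdP => [[i [j [eij]]]|[z [i [zs zi mi]]]]; last first.
  by exists z, i; rewrite !mnmDE msetE zs; split=> //; rewrite addn_gt0 mi orbT.
rewrite !mnmDE !msetE !addn_gt0 !lt0b => mi mj.
have [z zs [zi|zj]] := sigma_cover eij.
  exists z, i; split=> //; case/orP: mi => // /(sigma_indep zs).
  by rewrite zi.
exists z, j; split=> //; case/orP: mj => // /(sigma_indep zs).
by rewrite zj.
Qed.

Lemma colon_sigmaP (g : S) :
  colon J 'X_[mset sigma] g <-> mfilter (predC meets_nbhd) g = 0.
Proof.
rewrite /colon; split=> [/edge_idealP h|g0]; last first.
  apply/edge_idealP => m /msuppM_le /allpairsP [[m1 m2] /= [m1g]].
  rewrite msuppX inE => /eqP-> ->; rewrite addmC has_edge_sigma.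
  apply: contraLR m1g => nm1; rewrite -mcoeff_eq0.
  by move/mpolyP/(_ m1): g0; rewrite mcoeff_filter /= nm1 mcoeff0 => ->.
apply/mpolyP => m; rewrite mcoeff_filter mcoeff0 /=; case: ifP => // nm.
apply/eqP; rewrite mcoeff_eq0; apply: contraFN (negbTE nm) => mg.
by rewrite -has_edge_sigma; apply: h; rewrite mcoeff_msupp mcoeffMX -mcoeff_msupp.
Qed.

(** The colon ideal is the kernel of the ring map that sets the variables in $N(\sigma)$ to zero;
    its values lie in a domain, so the kernel is prime. *)
Lemma vnumber_le v : is_vnumber J v -> (v <= #|sigma|)%N.
Proof.
case=> _; apply; exists 'X_[mset sigma], (colon J 'X_[mset sigma]).
split=> //; first by rewrite dhomogX; apply/eqP; exact: mdeg_mset.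
split; last by exists 'X_[mset sigma].
have filM f g : mfilter (predC meets_nbhd) (f * g) =
    mfilter (predC meets_nbhd) f * mfilter (predC meets_nbhd) g.
  by apply: mfilterM => m1 m2 _ _; rewrite /= meets_nbhdD negb_or.
split=> [||f g].
- split=> [|f g|a f].
  + by apply/colon_sigmaP; rewrite raddf0.
  + by rewrite !colon_sigmaP raddfD /= => -> ->; rewrite addr0.
  + by rewrite !colon_sigmaP filM => ->; rewrite mulr0.
- rewrite colon_sigmaP => /mpolyP/(_ 0%MM); rewrite mcoeff_filter mcoeff0 mcoeff1 eqxx /=.
  case: ifP => [_ /eqP|/negbFE /meets_nbhdP [z [i [_ _]]]]; first by rewrite oner_eq0.
  by rewrite mnm0E.
- by rewrite !colon_sigmaP filM => /eqP; rewrite mulf_eq0 => /orP[]/eqP; auto.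
Qed.

End VNumber.

(** * The lower bound on the regularity *)

Section Regularity.
Variables (sigma T : {set I}) (r : int).
Hypotheses (T_nbhd : forall t, t \in T -> exists2 z, z \in sigma & e z t).

(** The monomial $x^\sigma$ is lifted homogeneously to the first free module, the lift of $x^\sigma
    e_T$ is filled there, and the filling is pushed down by [aug F]. *)
Lemma koszul_cycle_bounds : is_regularity J r -> r < #|sigma|%:Z ->
  exists Y : {set I} -> S, forall T' : {set I},
    J ((if T' == T then 'X_[mset sigma] else 0) -
       \sum_(t | t \notin T') flip (below t T') ('X_t * Y (t |: T'))).
Proof.
case=> F [_ rmax] r_lt.
have shift_le q (k : 'I_(rank F q)) : shift k <= r + q%:Z.
  rewrite -lerBlDr; apply: rmax; exists q, (shift k); split=> //.
  by apply/eqP; rewrite -lt0n; apply/card_gt0P; exists k; rewrite inE.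
have [u0 u0E] := aug_surjective F 'X_[mset sigma].
pose n : int := #|sigma|%:Z.
pose u1 : 'rV[S]_(rank F 0) := \row_l mfilter (fun m => (mdeg m)%:Z == n - shift l) (u0 0 l).
have u1E : J ('X_[mset sigma] - (u1 *m aug F) 0 0).
  have -> : 'X_[mset sigma] - (u1 *m aug F) 0 0 =
      mfilter (fun m => (mdeg m)%:Z == n) ('X_[mset sigma] - (u0 *m aug F) 0 0).
    rewrite raddfB /= filter_homogeneous; last first.
      by rewrite /n -mdeg_mset; apply: homogeneousX.
    congr (_ - _); rewrite !mxE raddf_sum; apply: eq_bigr => l _; rewrite mxE /=.
    rewrite -{2}(subrK (shift l) n) filter_homogeneousM //.
    exact: aug_graded.
  exact: edge_ideal_filter.
pose u : {ffun {set I} -> 'rV[S]_(rank F 0)} := [ffun T' => if T' == T then u1 else 0].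
have aug_koszul (x : {ffun {set I} -> 'rV[S]_(rank F 0)}) T' :
    (koszul x T' *m aug F) 0 0 =
    \sum_(t | t \notin T') flip (below t T') ('X_t * (x (t |: T') *m aug F) 0 0).
  rewrite koszul_mulmx koszulE summxE; apply: eq_bigr => t _; rewrite ffunE /flip.
  by case: ifP; rewrite !mxE.
have [||||y yE] :=
  koszul_cycle_boundary shift_le (i := #|T|) (q := 0) (d := n) (u := u).
- by rewrite addr0.
- move=> T' k; rewrite ffunE; case: ifP => _; rewrite mxE.
    exact: homogeneous_filter.
  exact: homogeneous0.
- by move=> T' T'T; rewrite ffunE ifN //; apply: contraNneq T'T => ->.
(* The cycle condition holds modulo the ideal: each [t] in [T] has a neighbour in [sigma], so $x_t
   x^\sigma$ lies in it. *)
- move=> T'; apply/aug_exact; rewrite aug_koszul.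
  elim/big_ind: _ => [||t tT']; [exact: edge_ideal0|exact: edge_idealD|].
  have : J ('X_t * (u (t |: T') *m aug F) 0 0).
    rewrite ffunE; case: eqP => [eT|_]; last by rewrite mul0mx mxE mulr0; apply: edge_ideal0.
    have tT : t \in T by rewrite -eT setU11.
    have [z zs zt] := T_nbhd tT.
    have -> : 'X_t * (u1 *m aug F) 0 0 =
        'X_t * 'X_[mset sigma] - 'X_t * ('X_[mset sigma] - (u1 *m aug F) 0 0) by ring.
    apply: edge_idealD; last by apply/edge_idealN/edge_idealM.
    apply/edge_idealP => m; rewrite -mpolyXD msuppX inE => /eqP->.
    apply/has_edgeP; exists z, t; split=> //.
      by rewrite mnmDE msetE zs addn1.
    by rewrite mnmDE mnm1E eqxx.
  by rewrite /flip; case: ifP => // _; apply: edge_idealN.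
exists (fun T' => (y T' *m aug F) 0 0) => T'.
have : J (((u T' - koszul y T') *m aug F) 0 0) by apply/aug_exact; exact: yE.
rewrite mulmxBl mxE [X in _ + X]mxE aug_koszul => hJ.
rewrite -(subrKA ((u T' *m aug F) 0 0)); apply: edge_idealD hJ.
rewrite ffunE; case: (T' == T); first exact: u1E.
by rewrite mul0mx mxE subr0; apply: edge_ideal0.
Qed.

(* [psi] pairs to [psi sigma != 0] with the Koszul cycle [x^sigma e_T] and to [0]
   with every boundary, in the squarefree multidegree [sigma :|: T]. *)
Lemma regularity_ge (psi : {ffun {set I} -> K}) :
  [disjoint sigma & T] -> is_regularity J r ->
  psi sigma != 0 -> simplicial_boundary psi = 0 ->
  (forall R, psi R != 0 -> R \subset sigma :|: T /\ independent R) ->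
  #|sigma|%:Z <= r.
Proof.
move=> sT regr psi_sigma psi_cycle psi_supp.
rewrite leNgt; apply/negP => r_lt.
have [Y YE] := koszul_cycle_bounds regr r_lt.
pose W := sigma :|: T.
(* The component of [Y] in multidegree [W], indexed by complements; the parity sign turns the Koszul
   differential into a sum of exterior multiplications. *)
pose y : {ffun {set I} -> K} :=
  [ffun R => flip (parity W (W :\: R)) (Y (W :\: R))@_(mset R)].
have key (R : {set I}) : R \subset W -> independent R ->
    flip (parity W (W :\: R)) (R == sigma)%:R = \sum_t wedge t y R.
  move=> RW iR.
  (* For independent [R] the monomial $x^R$ is outside the ideal, so its coefficient in an element
     of the ideal vanishes. *)
  have cE : ((if W :\: R == T then 'X_[mset sigma] else 0 : S) -
       \sum_(t | t \notin W :\: R)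
         flip (below t (W :\: R)) ('X_t * Y (t |: (W :\: R))))@_(mset R) = 0.
    apply/eqP; rewrite mcoeff_eq0; apply/negP => /(iffLR (edge_idealP _) (YE _)).
    exact/negP/has_edge_mset.
  have sigmaE : (if W :\: R == T then 'X_[mset sigma] else 0 : S)@_(mset R) = (R == sigma)%:R.
    have -> : (W :\: R == T) = (R == sigma).
      have sT0 : sigma :\: T = sigma by apply/setDidPl.
      have Ts0 : T :\: sigma = T by apply/setDidPl; rewrite disjoint_sym.
      apply/eqP/eqP => [WT|->]; last by rewrite /W setDUl setDv set0U.
      have <- : W :\: (W :\: R) = R by rewrite setDDr setDv set0U; apply/setIidPr.
      by rewrite WT /W setDUl setDv setU0.
    case: eqP => [->|_]; last by rewrite mcoeff0.
    by rewrite mcoeffX eqxx.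
  move: cE; rewrite mcoeffB sigmaE => /eqP; rewrite subr_eq0 => /eqP->.
  rewrite linear_sum /= [X in flip _ X]big_mkcond /=.
  have -> (b : bool) (G : I -> K) : flip b (\sum_t G t) = \sum_t flip b (G t).
    by case: b; rewrite /flip // sumrN.
  apply: eq_bigr => t _; rewrite !ffunE.
  have mcoeff_flip b (p : S) m : (flip b p)@_m = flip b p@_m.
    by case: b; rewrite /flip ?mcoeffN.
  case: (boolP (t \in R)) => tR; last first.
    by case: ifP => _; rewrite ?flip0 // mcoeff_flip mcoeff_mulX msetE (negPf tR) !flip0.
  rewrite inE tR /= mcoeff_flip mcoeff_mulX msetE tR /= mset_setD1 //.
  have -> : t |: (W :\: R) = W :\: (R :\ t).
    apply/setP => x; rewrite !inE; case: eqVneq => [->|//] /=.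
    by have := subsetP RW t tR; rewrite inE => ->.
  rewrite !flip_flip parity_setD1 // (below_split RW tR); congr flip.
  by case: (below _ _); case: (below _ _); case: (parity _ _).
(* By adjointness this is the pairing of the boundary of [psi] with [y]; evaluated through [key], it
   leaves only the term at [sigma]. *)
have : \sum_R psi R * (\sum_t wedge t y R) = 0.
  under eq_bigr => R _ do rewrite mulr_sumr.
  rewrite exchange_big /=.
  under eq_bigr => t _ do rewrite sum_mul_wedge.
  rewrite exchange_big big1 //= => R _; rewrite -mulr_suml.
  move: psi_cycle; rewrite simplicial_boundaryE => /ffunP/(_ R).
  by rewrite sum_ffunE ffunE => ->; rewrite mul0r.
have eR R : psi R * (\sum_t wedge t y R) =
    psi R * flip (parity W (W :\: R)) (R == sigma)%:R.
  have [->|/psi_supp [RW iR]] := eqVneq (psi R) 0; first by rewrite !mul0r.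
  by rewrite key.
rewrite (eq_bigr _ (fun R _ => eR R)) (bigD1 sigma) //= big1 ?addr0 => [|R /negPf Rs].
  move/eqP; rewrite mulf_eq0 (negPf psi_sigma) flip_eq0 eqxx /=.
  by rewrite oner_eq0.
by rewrite Rs flip0 mulr0.
Qed.

End Regularity.
End EdgeIdeal.

(** * Cycles of the independence complex *)

Section Certificate.
Variables (K : fieldType) (s : nat) (e : rel 'I_s).
Hypotheses (e_sym : symmetric e) (e_irr : irreflexive e).
Local Notation I := 'I_s.
Local Notation E := {ffun {set I} -> K}.
Local Notation independent := (independent e).
Local Notation apart := (apart e).

Record certificate (U sigma T : {set I}) (psi : E) : Prop := Certificate {
  cert_sigmaU : sigma \subset U;
  cert_TU : T \subset U;
  cert_indep : independent sigma;
  cert_cover : forall x y, x \in U -> y \in U -> e x y ->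
    exists2 z, z \in sigma & e z x \/ e z y;
  cert_nbhd : forall t, t \in T -> exists2 z, z \in sigma & e z t;
  cert_nz : psi sigma != 0;
  cert_cycle : simplicial_boundary psi = 0;
  cert_supp : forall R : {set I}, psi R != 0 -> R \subset sigma :|: T /\ independent R
}.

(** The empty face is a cycle of the augmented complex. *)
Lemma certificate_edgeless (U : {set I}) :
  (forall x y, x \in U -> y \in U -> ~~ e x y) ->
  certificate U set0 set0 [ffun R : {set I} => (R == set0)%:R].
Proof.
move=> noe; split; rewrite ?sub0set //.
- by move=> x y; rewrite inE.
- by move=> x y xU yU; rewrite (negPf (noe x y xU yU)).
- by move=> t; rewrite inE.
- by rewrite ffunE eqxx oner_eq0.
- apply/ffunP => R; rewrite simplicial_boundaryE sum_ffunE ffunE big1 // => t _.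
  rewrite !ffunE (_ : t |: R == set0 = false) ?flip0 ?if_same //.
  by apply/negP => /eqP/setP/(_ t); rewrite !inE eqxx.
- move=> R; rewrite ffunE; case: (R =P set0) => [->|_]; last by rewrite eqxx.
  by rewrite sub0set => _; split=> // x y; rewrite inE.
Qed.

Lemma wedge_neq0 (V : zmodType) t (u : {ffun {set I} -> V}) R :
  wedge t u R != 0 -> t \in R /\ u (R :\ t) != 0.
Proof. by rewrite ffunE; case: ifP => _; rewrite ?eqxx // flip_eq0. Qed.

Lemma simplicial_boundary_neq0 (V : zmodType) (u : {ffun {set I} -> V}) R :
  simplicial_boundary u R != 0 -> exists2 t, t \notin R & u (t |: R) != 0.
Proof.
rewrite simplicial_boundaryE sum_ffunE => nz.
suff /existsP [t] : [exists t, contr t u R != 0].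
  by rewrite ffunE; case: ifP; rewrite ?eqxx // => /negbT tR; rewrite flip_eq0; exists t.
apply: contraNT nz; rewrite negb_exists => /forallP z.
by rewrite big1 // => t _; apply/eqP; rewrite -[_ == _]negbK.
Qed.

Lemma independent_setU1 (R : {set I}) t : t \in R -> independent (R :\ t) ->
  (forall x, x \in R :\ t -> ~~ e t x) -> independent R.
Proof.
move=> tR iR tx x y xR yR.
have [->|xt] := eqVneq x t; have [->|yt] := eqVneq y t; rewrite ?e_irr //.
- by apply: tx; rewrite !inE yt.
- by rewrite e_sym; apply: tx; rewrite !inE xt.
- by apply: iR; rewrite !inE ?xt ?yt.
Qed.

(** The chain [psi] splits into [psiA], whose faces contain no neighbour of [w1], and [psiB], whose
    faces contain one and therefore, by [join] and independence, no neighbour of [w3]. Each part can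
    be coned off separately. *)
Lemma certificate_step (U : {set I}) w1 w2 w3 sigma T psi :
  w1 \in U -> w2 \in U -> w3 \in U -> e w1 w2 -> e w3 w2 -> ~~ e w1 w3 ->
  (forall v1 v3, v1 \in U -> v3 \in U -> apart w2 v1 -> apart w2 v3 ->
     e w1 v1 -> e w3 v3 -> e v1 v3) ->
  certificate (U :&: [set z | apart w2 z]) sigma T psi ->
  exists psi', certificate U (w2 |: sigma) (w1 |: (w3 |: T)) psi'.
Proof.
move=> w1U w2U w3U w12 w32 w13 join [sU TU isig cov nbhd psi_nz psi_cyc psi_supp].
set H := U :&: _ in sU TU cov.
have HP x : x \in H -> [/\ x \in U, x != w2, ~~ e w2 x, x != w1 & x != w3].
  rewrite !inE => /and3P[xU w2x nw2x]; split=> //; first by rewrite eq_sym.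
  - by apply: contraNneq nw2x => ->; rewrite e_sym.
  - by apply: contraNneq nw2x => ->; rewrite e_sym.
have suppH (R : {set I}) : psi R != 0 -> R \subset H.
  by case/psi_supp=> RW _; apply: subset_trans RW _; rewrite subUset sU.
pose A (R : {set I}) := [exists z in R, e w1 z].
pose psiA : E := [ffun R => if A R then 0 else psi R].
pose psiB : E := psi - psiA.
pose dA := simplicial_boundary psiA.
have dB : simplicial_boundary psiB = - dA by rewrite raddfB /= psi_cyc sub0r.
(* The cone from [w2] minus a second filling of [psi]; the last term repairs the common boundary
   [dA] along which the cones from [w1] and [w3] meet. *)
pose psi' : E := wedge w2 psi - wedge w1 psiA - wedge w3 psiB + wedge w1 (wedge w3 dA).
have suppA (R : {set I}) : psiA R != 0 -> psi R != 0 /\ {in R, forall z, ~~ e w1 z}.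
  rewrite ffunE; case: ifP => [_|/negbT]; first by rewrite eqxx.
  by rewrite negb_exists_in => /forall_inP RA ?; split.
have suppB (R : {set I}) : psiB R != 0 -> psi R != 0 /\ {in R, forall z, ~~ e w3 z}.
  rewrite !ffunE; case: ifP => [AR|_]; last by rewrite subrr eqxx.
  rewrite subr0 => nz; split=> // z zR; apply/negP => w3z.
  have /exists_inP [x xR w1x] := AR.
  have /subsetP RH := suppH R nz; have [_ iR] := psi_supp R nz.
  have [xU xw2 w2x _ _] := HP x (RH x xR); have [zU zw2 w2z _ _] := HP z (RH z zR).
  have /negP[] := iR x z xR zR.
  by apply: join => //; rewrite /apart 1?eq_sym ?xw2 ?zw2.
(* Up to sign [dA] is the boundary of both [psiA] and [psiB], so its faces avoid the neighbours of
   [w1] and of [w3]. *)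
have suppD (R : {set I}) : dA R != 0 ->
    [/\ R \subset sigma :|: T, independent R,
        {in R, forall z, ~~ e w1 z} & {in R, forall z, ~~ e w3 z}].
  move=> nz; have [t tR /suppA [nzt tA]] := simplicial_boundary_neq0 nz.
  have [tRW tRi] := psi_supp _ nzt.
  have nzB : simplicial_boundary psiB R != 0 by rewrite dB ffunE oppr_eq0.
  have [t' t'R /suppB [_ tB]] := simplicial_boundary_neq0 nzB.
  split.
  - by apply: subset_trans tRW; apply: subsetUr.
  - by move=> x y xR yR; apply: tRi; rewrite inE ?xR ?yR orbT.
  - by move=> z zR; apply: tA; rewrite inE zR orbT.
  - by move=> z zR; apply: tB; rewrite inE zR orbT.
have sW : sigma :|: T \subset (w2 |: sigma) :|: (w1 |: (w3 |: T)).
  by apply/subsetP=> z; rewrite !inE => /orP[]->; rewrite !orbT.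
have supp1 (R : {set I}) t : t \in [:: w1; w2; w3] -> t \in R ->
    R :\ t \subset (w2 |: sigma) :|: (w1 |: (w3 |: T)) ->
    R \subset (w2 |: sigma) :|: (w1 |: (w3 |: T)).
  rewrite !inE => tw tR RW; rewrite -(setD1K tR) subUset RW andbT sub1set !inE.
  by case/or3P: tw => /eqP->; rewrite eqxx ?orbT.
exists psi'; split.
- by rewrite subUset sub1set w2U (subset_trans sU) // subsetIl.
- by rewrite !subUset !sub1set w1U w3U (subset_trans TU) // subsetIl.
- apply: (@independent_setU1 _ w2); rewrite ?setU11 //.
    have w2s : w2 \notin sigma by apply/negP => /(subsetP sU)/HP[]; rewrite eqxx.
    by rewrite setU1K.
  move=> x; rewrite !inE => /andP[/negPf-> /= /(subsetP sU)/HP[]] //.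
- move=> x y xU yU exy.
  have [w2x|nw2x] := boolP (e w2 x); first by exists w2; rewrite ?setU11; auto.
  have [w2y|nw2y] := boolP (e w2 y); first by exists w2; rewrite ?setU11; auto.
  have xH : x \in H.
    by rewrite !inE xU /apart nw2x andbT; apply: contraNneq nw2y => ->.
  have yH : y \in H.
    by rewrite !inE yU /apart nw2y andbT; apply: contraNneq nw2x => ->; rewrite e_sym.
  by have [z zs h] := cov x y xH yH exy; exists z; rewrite // inE zs orbT.
- move=> t; rewrite !inE => /or3P[/eqP->|/eqP->|/nbhd [z zs zt]].
  + by exists w2; rewrite ?setU11 // e_sym.
  + by exists w2; rewrite ?setU11 // e_sym.
  + by exists z; rewrite // inE zs orbT.
(* Neither [w1] nor [w3] lies in [w2 |: sigma], so only the cone from [w2] contributes there, with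
   the value [psi sigma] up to sign. *)
- have out w : e w w2 -> w \notin w2 |: sigma.
    move=> ww2; rewrite !inE negb_or; apply/andP; split.
      by apply: contraTneq ww2 => ->; rewrite e_irr.
    by apply/negP => /(subsetP sU)/HP[_ _]; rewrite e_sym ww2.
  have w2s : w2 \notin sigma by apply/negP => /(subsetP sU)/HP[]; rewrite eqxx.
  rewrite /psi' !ffunE setU11 (negPf (out w1 w12)) (negPf (out w3 w32)).
  by rewrite setU1K // !oppr0 !addr0 flip_eq0.
- have bB (x y : E) : simplicial_boundary (x - y) = simplicial_boundary x - simplicial_boundary y.
    exact: raddfB.
  rewrite [LHS]raddfD /= !bB !simplicial_boundary_wedge psi_cyc dB.
  rewrite simplicial_boundary_boundary [wedge w2 0]raddf0 [wedge w3 0]raddf0.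
  rewrite [wedge w3 (- _)]raddfN !subr0 /psiB -/dA /=.
  move: (wedge w1 dA) (wedge w3 dA) => x y.
  by apply/ffunP => R; rewrite !ffunE; ring.
- move=> R.
  have [/wedge_neq0 [tR nz] _|/negPn/eqP z2] := boolP (wedge w2 psi R != 0).
    have [RW iR] := psi_supp _ nz; split.
      by apply: (supp1 _ w2) => //; rewrite ?inE ?eqxx ?orbT //; apply: subset_trans RW sW.
    apply: (independent_setU1 tR iR) => x /(subsetP (suppH _ nz))/HP[] //.
  have [/wedge_neq0 [tR /suppA [nz nA]] _|/negPn/eqP z1] := boolP (wedge w1 psiA R != 0).
    have [RW iR] := psi_supp _ nz; split.
      by apply: (supp1 _ w1) => //; rewrite ?inE ?eqxx ?orbT //; apply: subset_trans RW sW.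
    by apply: (independent_setU1 tR iR) => x /nA.
  have [/wedge_neq0 [tR /suppB [nz nB]] _|/negPn/eqP z3] := boolP (wedge w3 psiB R != 0).
    have [RW iR] := psi_supp _ nz; split.
      by apply: (supp1 _ w3) => //; rewrite ?inE ?eqxx ?orbT //; apply: subset_trans RW sW.
    by apply: (independent_setU1 tR iR) => x /nB.
  rewrite /psi' 3!ffunE z2 ffunE z1 ffunE z3 !oppr0 !add0r.
  case/wedge_neq0=> tR1 /wedge_neq0 [tR3 /suppD [RW iR nA nB]]; split.
    apply: (supp1 _ w1) => //; first by rewrite !inE eqxx.
    apply: (supp1 _ w3) => //; first by rewrite !inE eqxx !orbT.
    exact: subset_trans RW sW.
  apply: (independent_setU1 tR1) => [|x xR].
    by apply: (independent_setU1 tR3 iR) => x /nB.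
  have [->|xw3] := eqVneq x w3; first exact: w13.
  by apply: nA; rewrite in_setD1 xw3.
Qed.

Hypothesis no_cycle : forall p, chordless_cycle e p -> size p = 3%N \/ size p = 5%N.

Lemma exists_certificate (U : {set I}) : exists sigma T psi, certificate U sigma T psi.
Proof.
have [n] := ubnP #|U|; elim: n => // n IHn in U *; rewrite ltnS => Un.
have [/existsP [a /existsP [b /and3P[aU bU ab]]]|noe] :=
  boolP [exists a, exists b, [&& a \in U, b \in U & e a b]]; last first.
  exists set0, set0, [ffun R : {set I} => (R == set0)%:R].
  apply: certificate_edgeless => x y xU yU; apply: contraNN noe => xy.
  by apply/existsP; exists x; apply/existsP; exists y; rewrite xU yU.
have [||w1 [w2 [w3 [[w1U w2U w3U] w12 w32 w13 join]]]] :=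
    exists_shedding_triple e_sym e_irr _ _ aU bU ab.
- by move=> p /no_cycle [|] ->.
- by move=> p /no_cycle [|] ->.
have [|sigma [T [psi cert]]] := IHn (U :&: [set z | apart w2 z]).
  apply: leq_trans Un; apply: proper_card; apply/properP; split; first exact: subsetIl.
  by exists w2; rewrite // !inE /apart eqxx andbF.
have [psi' cert'] := certificate_step w1U w2U w3U w12 w32 w13 join cert.
by exists (w2 |: sigma), (w1 |: (w3 |: T)), psi'.
Qed.

End Certificate.

Theorem corollary3p15 (K : fieldType) (s : nat) (e : rel 'I_s)
    (e_sym : symmetric e) (e_irr : irreflexive e)
    (no_cycle : forall p : seq 'I_s,
        chordless_cycle e p -> size p = 3%N \/ size p = 5%N)
    (v : nat) (r : int)
    (hv : is_vnumber (@edge_ideal K s e) v)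
    (hr : is_regularity (@edge_ideal K s e) r) :
  v%:Z <= r.
Proof.
have [sigma [T [psi cert]]] := exists_certificate K e_sym e_irr no_cycle setT.
have [_ _ isig cov nbhd nz cyc supp] := cert.
have vle : (v <= #|sigma|)%N.
  by apply: (vnumber_le e_irr isig _ hv) => x y xy; apply: cov.
apply: le_trans (regularity_ge e_irr nbhd _ hr nz cyc supp); first by rewrite lez_nat.
(* Disjointness: a common element of [sigma] and [T] would be adjacent to a vertex of the
   independent set [sigma]. *)
apply/pred0P => x /=; apply/negP => /andP[xs /nbhd [z zs]].
by apply/negP; apply: isig.
Qed.
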